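(* Let $k\ge3$ and $e>7$ be integers. If $e\equiv-2\pmod{3^k}$ or $e\equiv-7\pmod{3^k}$, then for all integers $n,w$ with $1\le w\le n-1$ there is no nontrivial $e$-perfect code in $J(n,w)$.
   Context: The Johnson scheme $J(n,w)$ has as elements all $w$-subsets of $[n]=\{1,\dots,n\}$, with distance $d(X,Y)=|X\setminus Y|$. The $e$-ball centred at $X$ is the set of $w$-subsets at distance at most $e$ from $X$. An $e$-perfect code in $J(n,w)$ is a set $\mathcal C$ of $w$-subsets such that the $e$-balls centred at the elements of $\mathcal C$ partition the set of all $w$-subsets of $[n]$. It is trivial if $e=0$, or $|\mathcal C|=1$, or $n=2w$, $w=2e+1$ and $\mathcal C$ consists of a $w$-subset and its complement; otherwise it is nontrivial. *)

(* Defs.v *)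
From mathcomp Require Import all_boot all_order all_algebra.

Set Implicit Arguments.
Unset Strict Implicit.
Unset Printing Implicit Defensive.

(* The ground set [n] = {1, ..., n} is modelled by 'I_n = {0, ..., n - 1}. *)

Definition johnson (n w : nat) : {set {set 'I_n}} :=
  [set X : {set 'I_n} | #|X| == w].

Definition jdist (n : nat) (X Y : {set 'I_n}) : nat := #|X :\: Y|.

Definition jball (n w e : nat) (X : {set 'I_n}) : {set {set 'I_n}} :=
  [set Y in johnson n w | jdist X Y <= e].

(* The balls partition johnson n w as a family indexed by C. The image set
   [set jball w e X | X in C] forgets multiplicities, so injectivity is needed
   to exclude distinct centres with the same ball (e.g. when e is at least the
   diameter and every ball is the whole scheme). *)
Definition perfect_code (n w e : nat) (C : {set {set 'I_n}}) : Prop :=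
  [/\ C \subset johnson n w,
      {in C &, injective (@jball n w e)} &
      partition [set jball w e X | X in C] (johnson n w)].

Definition trivial_code (n w e : nat) (C : {set {set 'I_n}}) : Prop :=
  [\/ e = 0,
      #|C| = 1 |
      [/\ n = 2 * w, w = 2 * e + 1 &
          exists2 X : {set 'I_n}, X \in johnson n w & C = [set X; ~: X]]].

(* Main.v *)
Require Import Defs.
From mathcomp Require Import all_boot all_order all_algebra.
From mathcomp Require Import zify ring.

(** Put b = n - w and let Phi be the size of an e-ball. By complementation,
    w <= b may be assumed. The contradiction comes from the valuation of Phi
    at 3: it is at least 2, but Phi divides binomial coefficients that are not
    multiples of 9.

    The lower bound on the valuation is local. The codewords nearest to a given
    codeword form Steiner systems S(e + 1, 2e + 1, w) and S(e + 1, 2e + 1, b)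
    (steiner_dvd). Since e = -2 or e = -7 modulo 27, the divisibility conditions
    of these systems leave two or three residues modulo 27 for w and b. For
    these residues, Phi = sum over i <= e of C(w, i) C(b, i) behaves 3-adically
    like the full Vandermonde convolution, and the carries in adding w and b
    show that 9 divides Phi (sq_dvd_ball_size, ball_size_div9).

    The other half is the design property. The function that is Phi - 1 on C and
    -1 on the other w-sets sums to zero over every ball, so C is a t-design as
    long as the eigenvalues of the ball operator on the eigenspaces 1, ..., t do
    not vanish; then Phi divides C(x + y, x) for all x <= w and y <= b with
    (w - x) + (b - y) <= t (ball_size_dvd). The eigenvalues are alternating sums
    whose terms increase in absolute value when w is large compared with e^2
    (ball_eigen_gt0).

    That w is so large follows from two inequalities. Counting how the
    words at distance e + 2 from a codeword are covered gives
    (w - 2e - 1)(b - 2e - 1) >= e(e + 1)(w + b - 4e - 2) (grid_bound); comparing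
    the ball with another set of diameter 2e gives the bound of Roos
    e(b - e) <= (e + 1)(w - e - 1) (roos_bound). With the divisibility of
    w - e by e + 1, they force w = b = 2e + 1, which is the trivial code, or w >= 2e^2 + 4e + 1
    (perfect_lower_bound). In the second case t may be any number below
    w / 2, and that is enough to reach from w and b, which differ by less than
    w / e, two numbers whose addition in base 3 has at most one carry
    (digit_choice). *)

Set Implicit Arguments.
Unset Strict Implicit.
Unset Printing Implicit Defensive.

(** * Counting subsets *)

(** Set identities are checked one element at a time: the inclusions of the
    context become implications between memberships of x, and all truth values
    of these memberships are tried. *)
Ltac set_taut x :=
  repeat match goal with
  | H : is_true (_ \subset _) |- _ => move/subsetP/(_ x)/implyP: H
  end;
  rewrite ?inE;
  repeat match goal with |- context [?y \in ?A] => case: (y \in A) end;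
  by [].

Section Counting.
Variable T : finType.
Implicit Types A B E I U X Y Z : {set T}.

Lemma card_between I U k : I \subset U -> #|I| <= k ->
  #|[set E : {set T} | [&& I \subset E, E \subset U & #|E| == k]]|
    = 'C(#|U| - #|I|, k - #|I|).
Proof.
move=> sIU leIk.
have <- : #|U :\: I| = #|U| - #|I| by rewrite cardsD (setIidPr sIU).
rewrite -cards_draws -[RHS](card_in_imset (f := fun A => I :|: A)); last first.
  move=> A B; rewrite !inE => /andP[sA _] /andP[sB _] eqAB.
  by apply/setP=> x; move/setP/(_ x): eqAB; set_taut x.
congr #|pred_of_set _|.
apply/setP=> E; rewrite inE; apply/and3P/imsetP.
  move=> [sIE sEU /eqP cE]; exists (E :\: I).
    by rewrite inE setSD // cardsD (setIidPr sIE) cE eqxx.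
  by apply/setP=> x; set_taut x.
case=> A; rewrite inE => /andP[sA /eqP cA] ->.
split; first exact: subsetUl.
  by apply/subsetP=> x; apply/implyP; set_taut x.
rewrite cardsU cA [_ :&: _](_ : _ = set0) ?cards0 ?subn0 ?subnKC //.
by apply/setP=> x; set_taut x.
Qed.

Lemma exists_subset U k : k <= #|U| ->
  exists2 A : {set T}, A \subset U & #|A| = k.
Proof.
rewrite -bin_gt0 -cards_draws => /card_gt0P[A].
by rewrite inE => /andP[sAU /eqP cA]; exists A.
Qed.

Lemma card_le_sum (P : pred {set T}) (h : {set T} -> nat) e :
  #|[set X | P X && (h X <= e)]|
    = \sum_(i < e.+1) #|[set X | P X && (h X == i)]|.
Proof.
rewrite -sum1_card.
under eq_bigl do rewrite inE.
rewrite (partition_big (fun X => inord (h X) : 'I_e.+1) predT) //=.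
apply: eq_bigr => i _; rewrite -sum1_card; apply: eq_bigl => X; rewrite inE.
have [leXe|ltXe] /= := leqP (h X) e.
  by rewrite andbT -val_eqE /= inordK.
by rewrite andbF /= (gtn_eqF (leq_ltn_trans (leq_ord i) ltXe)) andbF.
Qed.

Lemma eq_card_setD X Y : #|X| = #|Y| -> #|Y :\: X| = #|X :\: Y|.
Proof. by move=> cX; rewrite !cardsD cX setIC. Qed.

(** A set X with as many elements as Y is determined by Y :\: X and X :\: Y,
    which have the same size i; to contain I, the former must avoid I and the
    latter must contain I :\: Y. *)
Lemma card_sphere I Y i :
  #|[set X : {set T} | [&& I \subset X, #|X| == #|Y| & #|X :\: Y| == i]]|
    = (#|I :\: Y| <= i)
      * ('C(#|Y :\: I|, i) * 'C(#|~: (Y :|: I)|, i - #|I :\: Y|)).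
Proof.
have [leji|ltij] := leqP #|I :\: Y| i; last first.
  rewrite mul0n; apply: eq_card0 => X; rewrite inE; apply/negP=> /and3P[sIX _ /eqP cX].
  by move: (subset_leq_card (setSD Y sIX)); rewrite cX leqNgt ltij.
rewrite mul1n -cards_draws -(cards_draws (~: _)) -cardsX.
pose f (RS : {set T} * {set T}) := (Y :\: RS.1) :|: ((I :\: Y) :|: RS.2).
rewrite -[RHS](card_in_imset (f := f)); last first.
  move=> [R S] [R' S']; rewrite !inE /= => /andP[/andP[sR _] /andP[sS _]].
  move=> /andP[/andP[sR' _] /andP[sS' _]] eqf.
  by congr (_, _); apply/setP=> x; move/setP/(_ x): eqf; rewrite /f /=; set_taut x.
congr #|pred_of_set _|; apply/setP=> X; rewrite inE; apply/and3P/imsetP.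
  move=> [sIX /eqP cX /eqP cXY].
  exists (Y :\: X, (X :\: Y) :\: I).
    rewrite !inE /= setDS // eq_card_setD // cXY eqxx /=; apply/andP; split.
      by apply/subsetP=> x; apply/implyP; set_taut x.
    rewrite cardsD cXY; apply/eqP; congr (_ - #|pred_of_set _|).
    by apply/setP=> x; set_taut x.
  by rewrite /f /=; apply/setP=> x; set_taut x.
case=> [[R S]]; rewrite !inE /= => /andP[/andP[sR /eqP cR] /andP[sS /eqP cS]] ->.
have eD : f (R, S) :\: Y = (I :\: Y) :|: S.
  by rewrite /f /=; apply/setP=> x; set_taut x.
have cD : #|f (R, S) :\: Y| = i.
  rewrite eD cardsU cS [_ :&: _](_ : _ = set0) ?cards0 ?subn0 ?subnKC //.
  by apply/setP=> x; set_taut x.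
have eR : Y :\: f (R, S) = R by rewrite /f /=; apply/setP=> x; set_taut x.
split; [| | exact/eqP].
  by rewrite /f /=; apply/subsetP=> x; apply/implyP; set_taut x.
by rewrite -(cardsID Y (f _)) -(cardsID (f (R, S)) Y) cD eR cR setIC eqxx.
Qed.

End Counting.

(** * The excess of a perfect code and the ball operator *)

Definition ball_size (w b e : nat) : nat := \sum_(i < e.+1) 'C(w, i) * 'C(b, i).

(** Working over any finite type makes complementation, which exchanges the
    weights w and b = #|T| - w, available without transport. *)
Definition perfect (T : finType) (w e : nat) (C : {set {set T}}) : Prop :=
  (forall X, X \in C -> #|X| = w) /\
  (forall Y : {set T}, #|Y| = w -> #|[set X in C | #|X :\: Y| <= e]| = 1).

Section Design.
Import GRing.Theory.
Local Open Scope ring_scope.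
Variables (T : finType) (w b e : nat) (C : {set {set T}}).
Implicit Types I J K X Y Z : {set T}.
Let Phi := ball_size w b e.

(** A code is perfect exactly when this function sums to zero over every
    ball, and it is a t-design exactly when the function also sums to zero
    over the w-sets containing any given set of at most t elements. *)
Definition excess X : int :=
  if #|X| == w then (Phi * (X \in C))%:Z - 1 else 0.

Definition excess_between K J : int :=
  \sum_(X : {set T} | (K \subset X) && (X \subset ~: J)) excess X.

Lemma excess_betweenU K J z :
  excess_between K (z |: J) = excess_between K J - excess_between (z |: K) J.
Proof.
rewrite {1 2}/excess_between [X in _ = X - _](bigID (fun X : {set T} => z \in X)) /=.
rewrite [X in _ = X + _ - _](_ : _ = excess_between (z |: K) J) /=.
  rewrite addrAC subrr add0r; apply: eq_bigl => X.
  by rewrite setCU subsetI subsetC sub1set inE andbCA andbC.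
apply: eq_bigl => X; rewrite subUset sub1set.
by case: (z \in X); rewrite ?andbF ?andbT.
Qed.

(** Inclusion-exclusion: moving one element from the forbidden set J to the
    required set K changes the sign, because the sum with that element left
    unconstrained runs over the w-sets constrained by fewer than m elements. *)
Lemma excess_between_sign m (K J : {set T}) :
    (forall I, (#|I| < m)%N -> excess_between I set0 = 0) ->
    K \subset ~: J -> (#|K| + #|J| <= m)%N ->
  excess_between K J = (-1) ^+ #|J| * excess_between (K :|: J) set0.
Proof.
move=> null; move: {2}#|J| (erefl #|J|) => j; elim: j J K => [|j IHj] J K cJ.
  by rewrite cJ mul1r (cards0_eq cJ) setU0.
have [z zJ] : exists z, z \in J by apply/card_gt0P; rewrite cJ.
move=> dKJ le_m.
have cJ' : #|J :\ z| = j by move: cJ; rewrite (cardsD1 z J) zJ => -[].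
have zK : z \notin K by move: zJ; apply: contraL => /(subsetP dKJ); rewrite inE.
have dKJ' : K \subset ~: (J :\ z).
  by apply: subset_trans dKJ _; rewrite setCS subD1set.
have dzKJ' : z |: K \subset ~: (J :\ z).
  by rewrite subUset sub1set !inE eqxx.
have eU : z |: K :|: J :\ z = K :|: J.
  by apply/setP=> x; rewrite !inE; case: eqP => [->|_] //=; rewrite zJ orbT.
rewrite -{1}(setD1K zJ) excess_betweenU.
rewrite (IHj (J :\ z) K) ?(IHj (J :\ z) (z |: K)) //; last 2 first.
- by rewrite cardsU1 zK cJ'; lia.
- by rewrite cJ'; lia.
rewrite (null (K :|: J :\ z)); last first.
  apply: (leq_trans _ le_m); rewrite cJ addnS ltnS -cJ'; exact: (leq_card_setU _ _).1.
by rewrite mulr0 sub0r cJ' eU cJ exprS mulN1r mulNr.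
Qed.

Hypothesis card_T : #|T| = (w + b)%N.
Hypothesis perfC : perfect w e C.

Lemma card_setC_w Y : #|Y| = w -> #|~: Y| = b.
Proof. by move=> cY; rewrite cardsCs setCK cY card_T addKn. Qed.

Lemma card_ball Y : #|Y| = w ->
  #|[set X : {set T} | (#|X| == w) && (#|X :\: Y| <= e)%N]| = Phi.
Proof.
move=> cY; rewrite (card_le_sum (fun X => #|X| == w) (fun X => #|X :\: Y|)).
apply: eq_bigr => i _.
have := card_sphere set0 Y i.
rewrite setU0 !set0D cards0 leq0n mul1n setD0 subn0 cY card_setC_w // => <-.
by apply: eq_card => X; rewrite !inE sub0set.
Qed.

Lemma excess_ball Y : #|Y| = w ->
  \sum_(X : {set T} | (#|X| == w) && (#|X :\: Y| <= e)%N) excess X = 0.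
Proof.
move=> cY; rewrite (eq_bigr (fun X => (Phi * (X \in C))%:Z - 1)); last first.
  by move=> X /andP[cX _]; rewrite /excess cX.
rewrite big_split /= -(big_morph Posz PoszD (erefl _)) -big_distrr /=.
have -> : (\sum_(X : {set T} | (#|X| == w) && (#|X :\: Y| <= e)%N) (X \in C) = 1)%N.
  rewrite -(perfC.2 Y cY) -sum1_card.
  rewrite big_mkcond [RHS]big_mkcond /=; apply: eq_bigr => X _; rewrite inE.
  case XC: (X \in C); last by case: ifP.
  by rewrite (perfC.1 X XC) eqxx.
rewrite -(big_morph (@GRing.opp _) (@opprD _) (oppr0 _)) sumr_const.
have -> : #|[pred X : {set T} | (#|X| == w) && (#|X :\: Y| <= e)%N]| = Phi.
  by rewrite -(card_ball cY); apply: eq_card => X; rewrite inE.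
by rewrite muln1 natz subrr.
Qed.

(** The eigenvalue of the ball operator on the m-th eigenspace of the scheme,
    in the form in which it comes out of counting: for an m-set I and a w-set
    Y missing j elements of I, the inner sum is the number of w-sets containing
    I at distance at most e from Y. *)
Definition ball_eigen m : int :=
  \sum_(j < m.+1) (-1) ^+ j * 'C(m, j)%:Z
     * \sum_(i < e.+1) ((j <= i) * ('C(w - m + j, i) * 'C(b - j, i - j)))%N%:Z.

(** Sum the excess over all balls centred at the w-sets containing I. The total
    is zero. Collected by Y, the excess of Y is weighted by the number of such
    centres, which depends only on the number of elements of I that Y misses;
    grouping the Y by their trace on I, excess_between_sign turns
    every group into a signed copy of the excess over I. *)
Lemma excess_eigen m I :
    (forall I', (#|I'| < m)%N -> excess_between I' set0 = 0) ->
    #|I| = m -> (m <= w)%N ->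
  excess_between I set0 * ball_eigen m = 0.
Proof.
move=> null cI lemw.
pose nu j := \sum_(i < e.+1) ((j <= i) * ('C(w - m + j, i) * 'C(b - j, i - j)))%N%:Z.
have nuE Y : #|Y| = w -> 
  #|[set X : {set T} | ((I \subset X) && (#|X| == w)) && (#|X :\: Y| <= e)%N]|%:Z
    = nu #|I :\: Y|.
  move=> cY; rewrite (card_le_sum (fun X => (I \subset X) && (#|X| == w)) (fun X => #|X :\: Y|)).
  rewrite (big_morph Posz PoszD (erefl _)); apply: eq_bigr => i _; congr Posz.
  have := card_sphere I Y i; rewrite cY.
  have := cardsID Y I; have := cardsID I Y; rewrite setIC cY cI => cYI cIY.
  have -> : #|Y :\: I| = (w - m + #|I :\: Y|)%N by lia.
  have -> : #|~: (Y :|: I)| = (b - #|I :\: Y|)%N.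
    have := cardsC (Y :|: I); rewrite card_T cardsU cY cI setIC; lia.
  by move=> <-; apply: eq_card => X; rewrite !inE andbA.
have sum0 : \sum_(X : {set T} | (I \subset X) && (#|X| == w))
    \sum_(Y : {set T} | (#|Y| == w) && (#|Y :\: X| <= e)%N) excess Y = 0.
  by apply: big1 => X /andP[_ /eqP cX]; exact: excess_ball.
rewrite -[RHS]sum0 (exchange_big_dep (fun Y => #|Y| == w)) /=; last by move=> ? ? _ /andP[].
have -> : \sum_(Y : {set T} | #|Y| == w) \sum_(X : {set T} | 
      ((I \subset X) && (#|X| == w)) && ((#|Y| == w) && (#|Y :\: X| <= e)%N)) excess Y
   = \sum_(Y : {set T}) excess Y * nu #|I :\: Y|.
  rewrite big_mkcond /=; apply: eq_bigr => Y _; case: eqP => [cY|/eqP cY]; last first.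
    by rewrite /excess (negPf cY) mul0r.
  rewrite sumr_const -nuE // -mulr_natr natz; congr (_ * Posz _).
  apply: eq_card => X; rewrite !inE; apply: andb_id2l => /andP[_ /eqP cX].
  by rewrite -eq_card_setD // cX cY.
rewrite (partition_big (fun Y => I :&: Y) (fun K => K \subset I)) /=; last first.
  by move=> Y _; apply: subsetIl.
rewrite mulr_sumr.
rewrite (partition_big (fun K : {set T} => inord #|I :\: K| : 'I_m.+1) predT) //=.
apply: eq_bigr => j _.
transitivity (\sum_(K in [set K : {set T} | K \subset I & #|K| == (m - j)%N])
   excess_between I set0 * ((-1) ^+ j * nu j)).
  have lejm : (j <= m)%N by rewrite -ltnS.
  rewrite sumr_const cards_draws cI bin_sub // -mulr_natr natz.
  by rewrite -/(nu j); ring.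
rewrite big_mkcond [RHS]big_mkcond /=; apply: eq_bigr => K _; rewrite inE.
case: (boolP (K \subset I)) => //= sKI.
have cIK : #|I :\: K| = (m - #|K|)%N by rewrite cardsD (setIidPr sKI) cI.
have leKm := subset_leq_card sKI; rewrite cI in leKm.
rewrite -val_eqE /= inordK cIK ?ltnS ?leq_subr //.
have -> : (m - #|K| == j)%N = (#|K| == m - j)%N by have := ltn_ord j; lia.
case: eqP => // cK.
transitivity (\sum_(Y : {set T} | (K \subset Y) && (Y \subset ~: (I :\: K))) excess Y * nu j).
  rewrite -mulr_suml -/(excess_between _ _) (@excess_between_sign m K (I :\: K) null); last 2 first.
  - by apply/subsetP=> x; apply/implyP; set_taut x.
  - by rewrite cIK; lia.
  have -> : #|I :\: K| = j by have := ltn_ord j; lia.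
  have -> : K :|: I :\: K = I by rewrite -{1}(setIidPr sKI) setID.
  by ring.
apply: eq_big => Y.
  apply/andP/eqP=> [[sKY sYI]|<-].
    by apply/setP=> x; set_taut x.
  by split; apply/subsetP=> x; apply/implyP; set_taut x.
case/andP=> sKY sYI; congr (_ * nu _).
have -> : I :\: Y = I :\: K.
  by apply/setP=> x; set_taut x.
by have := ltn_ord j; lia.
Qed.
End Design.

(** * Positivity of the eigenvalues and the design property *)

Section Eigenvalue.
Import Order.TTheory GRing.Theory Num.Theory.
Local Open Scope ring_scope.

Lemma coef_1DXn (R : nzRingType) n k : ((1 + 'X : {poly R}) ^+ n)`_k = 'C(n, k)%:R.
Proof.
elim: n k => [|n IHn] k; first by rewrite expr0 coef1 bin0n.
rewrite exprS mulrDl mul1r coefD coefXM IHn.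
by case: k => [|k]; rewrite ?bin0 ?addr0 // IHn binS natrD.
Qed.

Lemma diagonal_expansion (S : comNzRingType) (B x A Y : S) c m :
  B * ((1 + Y) ^+ c * (x - A * Y) ^+ m)
    = \sum_(j < m.+1) (B * A ^+ j * (Y ^+ j * ((1 + Y) ^+ c * x ^+ (m - j))))
        *~ ((-1) ^+ j * 'C(m, j)%:Z).
Proof.
rewrite exprBn !mulr_sumr; apply: eq_bigr => j _.
rewrite -mulrzl rmorphM rmorphXn rmorphN rmorph1 /= -[_ *+ 'C(m, j)]mulr_natr.
by rewrite exprMn pmulrn; ring.
Qed.

(** Both sides are the coefficient of x^i y^i in
    (1 + x)^p (1 + y)^c (1 - xy)^m, the factor 1 - xy being expanded as
    (1 + y) - (1 + x) y on the left. *)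
Lemma bin_alternating_sum p c m i :
  \sum_(j < m.+1) (-1) ^+ j * 'C(m, j)%:Z
      * ((j <= i) * ('C(p + j, i) * 'C(c + (m - j), i - j)))%N%:Z
    = \sum_(j < m.+1) (-1) ^+ j * 'C(m, j)%:Z
      * ((j <= i) * ('C(p, i - j) * 'C(c, i - j)))%N%:Z.
Proof.
pose A : {poly {poly int}} := (1 + 'X)%:P.
have coefE (u : {poly int}) j n : 
    ((u%:P * ('X^j * (1 + 'X) ^+ n))`_i)`_i = u`_i * ((j <= i) * 'C(n, i - j))%N%:Z.
  rewrite coefCM coefXnM coef_1DXn.
  by case: leqP => _; rewrite ?mulr0 ?coef0 ?mulr0 // mul1n mulr_natr coefMn -mulr_natr natz.
have eq_poly : A ^+ p * ((1 + 'X) ^+ c * ((1 + 'X) - A * 'X) ^+ m)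
             = A ^+ p * ((1 + 'X) ^+ c * (1 - 'X%:P * 'X) ^+ m).
  have -> // : (1 + 'X) - A * 'X = 1 - 'X%:P * 'X.
  by rewrite /A polyCD polyC1 mulrDl mul1r opprD addrA addrK.
have := congr1 (fun q : {poly {poly int}} => (q`_i)`_i) eq_poly.
rewrite !diagonal_expansion !coef_sum => eq_coef.
transitivity (\sum_(j < m.+1) ((A ^+ p * A ^+ j *
    ('X^j * ((1 + 'X) ^+ c * (1 + 'X) ^+ (m - j))) *~ ((-1) ^+ j * 'C(m, j)%:Z))`_i)`_i).
  apply: eq_bigr => j _; rewrite !coefMrz -!exprD /A -rmorphXn coefE coef_1DXn natz -mulrzr intz.
  by rewrite !PoszM; ring.
rewrite eq_coef; apply: eq_bigr => j _.
rewrite !coefMrz expr1n mulr1 /A -!rmorphXn -rmorphM coefE coefMXn coef_1DXn.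
rewrite -mulrzr intz natz; have [leji|ltij] := leqP j i; last by rewrite !mul0n !mulr0 mul0r.
by rewrite !mul1n PoszM; ring.
Qed.

Lemma partial_alternating_bin n k :
  \sum_(j < k.+1) (-1) ^+ j * 'C(n.+1, j)%:Z = (-1) ^+ k * 'C(n, k)%:Z.
Proof.
elim: k => [|k IHk]; first by rewrite big_ord1 !bin0.
by rewrite big_ord_recr /= IHk binS exprS PoszD; ring.
Qed.

Lemma sum_Cauchy_partial (u v : nat -> int) e :
  \sum_(i < e.+1) \sum_(j < i.+1) u j * v (i - j)%N
    = \sum_(s < e.+1) (\sum_(j < (e - s).+1) u j) * v s.
Proof.
elim: e => [|e IHe]; first by rewrite !big_ord1.
rewrite big_ord_recr IHe /= [RHS]big_ord_recr /= subnn big_ord1.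
rewrite [X in _ + X = _](reindex_inj rev_ord_inj) /=.
rewrite [X in _ + X = _]big_ord_recr /= !subnn subn0 addrA.
congr (_ + _); rewrite -big_split /=; apply: eq_bigr => s _.
have les : (s <= e)%N by rewrite -ltnS.
rewrite !subSS subKn ?leqW // (subSn les).
by rewrite [X in _ = X * _]big_ord_recr /= mulrDl.
Qed.

(** Summing bin_alternating_sum over the radii produces partial alternating
    sums of the binomials of m, which collapse to binomials of m - 1. *)
Lemma ball_eigenE w b e m : (0 < m)%N -> (m <= b)%N ->
  ball_eigen w b e m
    = \sum_(s < e.+1) (-1) ^+ (e - s)
        * ('C(m.-1, e - s) * ('C(w - m, s) * 'C(b - m, s)))%N%:Z.
Proof.
case: m => // m _ lemb; rewrite /ball_eigen.
under eq_bigr => j _ do rewrite mulr_sumr.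
rewrite exchange_big /=.
transitivity (\sum_(i < e.+1) \sum_(j < i.+1) ((-1) ^+ j * 'C(m.+1, j)%:Z)
                 * ('C(w - m.+1, i - j) * 'C(b - m.+1, i - j))%N%:Z).
  apply: eq_bigr => i _.
  transitivity (\sum_(j < m.+2) (-1) ^+ j * 'C(m.+1, j)%:Z
      * ((j <= i) * ('C(w - m.+1 + j, i) * 'C(b - m.+1 + (m.+1 - j), i - j)))%N%:Z).
    apply: eq_bigr => j _; congr (_ * ((_ <= _) * (_ * 'C(_, _)))%N%:Z).
    by have := ltn_ord j; lia.
  rewrite bin_alternating_sum.
  have [leim|ltmi] := leqP i m.+1.
    rewrite [RHS](big_ord_widen m.+2 (fun j => (-1) ^+ j * 'C(m.+1, j)%:Z
        * ('C(w - m.+1, i - j) * 'C(b - m.+1, i - j))%N%:Z)) //.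
    rewrite [RHS]big_mkcond /=; apply: eq_bigr => j _; rewrite ltnS.
    by case: leqP => _; rewrite ?mul1n // mul0n mulr0.
  rewrite [LHS](eq_bigr (fun j : 'I__ => (-1) ^+ j * 'C(m.+1, j)%:Z
        * ('C(w - m.+1, i - j) * 'C(b - m.+1, i - j))%N%:Z)); last first.
    move=> j _; have -> : (j <= i)%N by have := ltn_ord j; lia.
    by rewrite mul1n.
  rewrite (big_ord_widen i.+1 (fun j => (-1) ^+ j * 'C(m.+1, j)%:Z
        * ('C(w - m.+1, i - j) * 'C(b - m.+1, i - j))%N%:Z)); last by lia.
  rewrite big_mkcond /=; apply: eq_bigr => j _.
  by case: leqP => // ltmj; rewrite bin_small // mulr0 mul0r.
rewrite (sum_Cauchy_partial (fun j => (-1) ^+ j * 'C(m.+1, j)%:Z)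
  (fun s => ('C(w - m.+1, s) * 'C(b - m.+1, s))%N%:Z)).
apply: eq_bigr => s _; rewrite partial_alternating_bin /=.
by rewrite [in RHS]PoszM mulrA.
Qed.

Lemma alternating_sum_gt0 (u : nat -> nat) e :
    (forall s, (s < e)%N -> (u s <= u s.+1)%N) -> (0 < e -> u e.-1 < u e)%N ->
    (0 < u e)%N ->
  0 < \sum_(s < e.+1) (-1) ^+ (e - s) * (u s)%:Z.
Proof.
move=> incr last_lt ue_gt0.
suff bound : forall k, (k <= e)%N ->
    0 <= \sum_(s < k.+1) (-1) ^+ (k - s) * (u s)%:Z <= (u k)%:Z.
  case: e incr last_lt ue_gt0 bound => [|e] incr last_lt ue_gt0 bound.
    by rewrite big_ord1 subnn mul1r ltz_nat.
  rewrite big_ord_recr /= subnn mul1r.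
  under eq_bigr => s _ do rewrite (subSn (leq_ord s)) exprS mulN1r mulNr.
  rewrite sumrN; have /andP[_ le_ue] := bound e (leqnSn e).
  rewrite addrC subr_gt0; apply: le_lt_trans le_ue _.
  by rewrite ltz_nat; apply: (last_lt isT).
elim=> [|k IHk] lek; first by rewrite big_ord1 subnn mul1r lexx andbT.
rewrite big_ord_recr /= subnn mul1r.
under eq_bigr => s _ do rewrite (subSn (leq_ord s)) exprS mulN1r mulNr.
rewrite sumrN addrC; have /andP[ge0 le_uk] := IHk (ltnW lek).
rewrite subr_ge0 gerBl ge0 andbT; apply: le_trans le_uk _.
by rewrite lez_nat; apply: incr.
Qed.

(** The terms of ball_eigenE alternate in sign. The ratio of two consecutive
    absolute values is smallest at the last step, where the hypothesis says that
    it exceeds 1; so the last term, which is positive, dominates. *)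
Lemma ball_eigen_gt0 w b e m : (0 < m)%N -> (m + e <= w)%N -> (m + e <= b)%N ->
    (m.-1 * e ^ 2 < (w - m - e).+1 * (b - m - e).+1)%N ->
  0 < ball_eigen w b e m.
Proof.
move=> m_gt0 lew leb small; rewrite ball_eigenE //; last by lia.
pose u s := ('C(m.-1, e - s) * ('C(w - m, s) * 'C(b - m, s)))%N.
(* The factor k clears the denominators of the ratio of u s.+1 to u s. *)
have step s : (s < e)%N ->
    exists Q k, [/\ (0 < k)%N, (k * u s = ((s.+1) ^ 2 * (m.-1 - (e - s.+1))) * Q)%N,
      (k * u s.+1 = ((e - s.+1).+1 * ((w - m - s) * (b - m - s))) * Q)%N,
      ((s.+1) ^ 2 * (m.-1 - (e - s.+1)) < (e - s.+1).+1 * ((w - m - s) * (b - m - s)))%N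
      & (e = s.+1 -> 0 < Q)%N].
  move=> lt_se; set d := (e - s.+1)%N; have eqd : (e - s = d.+1)%N by lia.
  exists ('C(m.-1, d) * ('C(w - m, s) * 'C(b - m, s)))%N, (d.+1 * s.+1 ^ 2)%N.
  have binM := mul_bin_left m.-1 d.
  have binp := mul_bin_left (w - m) s; have binc := mul_bin_left (b - m) s.
  split; first by [].
  - rewrite /u eqd; transitivity (s.+1 ^ 2 * (d.+1 * 'C(m.-1, d.+1))
      * ('C(w - m, s) * 'C(b - m, s)))%N; first by ring.
    by rewrite binM; ring.
  - rewrite /u -/d; transitivity (d.+1 * 'C(m.-1, d)
      * ((s.+1 * 'C(w - m, s.+1)) * (s.+1 * 'C(b - m, s.+1))))%N; first by ring.
    by rewrite binp binc; ring.
  - apply: (@leq_ltn_trans (m.-1 * e ^ 2)); last apply: (leq_trans small).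
      by rewrite mulnC leq_mul ?leq_subr // leq_exp2r.
    by apply: leq_trans (leq_pmull _ (ltn0Sn _)); apply: leq_mul; lia.
  - by move=> es; rewrite /d es subnn bin0 mul1n muln_gt0 !bin_gt0; lia.
have ue_gt0 : (0 < u e)%N.
  by rewrite /u subnn bin0 mul1n muln_gt0 !bin_gt0; lia.
apply: (@alternating_sum_gt0 u e _ _ ue_gt0) => [s lt_se|e_gt0].
  have [Q [k [k_gt0 eqs eqs1 lt_coef _]]] := step s lt_se.
  by rewrite -(leq_pmul2l k_gt0) eqs eqs1 leq_mul2r (ltnW lt_coef) orbT.
have lt_e : (e.-1 < e)%N by rewrite prednK.
have [Q [k [k_gt0 eqs eqs1 lt_coef]]] := step _ lt_e.
rewrite (prednK e_gt0) in eqs eqs1 lt_coef *.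
by move=> /(_ erefl) Q_gt0; rewrite -(ltn_pmul2l k_gt0) eqs eqs1 ltn_pmul2r.
Qed.
End Eigenvalue.

Section DesignStrength.
Import Order.TTheory GRing.Theory Num.Theory.
Variables (T : finType) (w b e t : nat) (C : {set {set T}}).
Hypothesis card_T : #|T| = w + b.
Hypothesis perfC : perfect w e C.
Hypotheses (le_tw : t + e <= w) (le_tb : t + e <= b).
Hypothesis small_t : t.-1 * e ^ 2 < (w - t - e).+1 * (b - t - e).+1.

(** Delsarte theory for this case: as long as the eigenvalues do not vanish,
    the code is a design. The case m = 0 of excess_eigen, where the eigenvalue
    is the ball size, starts the induction. *)
Lemma excess_null (I : {set T}) : #|I| <= t -> excess_between w b e C I set0 = 0%R.
Proof.
move: {2}#|I| (erefl #|I|) => m; elim/ltn_ind: m I => m IHm I cI le_It.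
have null (I' : {set T}) : #|I'| < m -> excess_between w b e C I' set0 = 0%R.
  by move=> lt_I'm; apply: (IHm _ lt_I'm _ erefl); lia.
have := excess_eigen card_T perfC null cI.
have le_mw : m <= w by lia.
move/(_ le_mw)/eqP; rewrite mulf_eq0 => /orP[/eqP //|].
suff /gt_eqF -> : (0 < ball_eigen w b e m)%R by [].
case: (posnP m) => [->|m_gt0].
  rewrite /ball_eigen big_ord1 bin0 mulr1 mul1r.
  rewrite big_ord_recl /= subn0 !bin0 ltr_pwDl //.
  by apply: sumr_ge0 => i _.
apply: ball_eigen_gt0; rewrite ?m_gt0 //; try lia.
apply: leq_ltn_trans (_ : t.-1 * e ^ 2 < _); first by rewrite leq_mul2r; lia.
by apply: leq_trans small_t _; apply: leq_mul; lia.
Qed.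

(** In the design C, the number of codewords containing a given (w - x)-set and
    avoiding a given disjoint (b - y)-set is the average C(x + y, x) / Phi,
    where Phi is the ball size. *)
Lemma ball_size_dvd x y : x <= w -> y <= b -> (w - x) + (b - y) <= t ->
  ball_size w b e %| 'C(x + y, x).
Proof.
move=> le_xw le_yb le_t.
have [I _ cI] : exists2 I : {set T}, I \subset [set: T] & #|I| = w - x.
  by apply: exists_subset; rewrite cardsT card_T; lia.
have [J sJ cJ] : exists2 J : {set T}, J \subset ~: I & #|J| = b - y.
  by apply: exists_subset; have := cardsC I; lia.
have sIJ : I \subset ~: J by rewrite subsetC.
have : excess_between w b e C I J = 0%R.
  rewrite (@excess_between_sign _ _ _ _ _ t) //; last by rewrite cI cJ.
    rewrite excess_null ?mulr0 //; apply: leq_trans (leq_card_setU _ _).1 _.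
    by rewrite cI cJ.
  by move=> I' lt_I't; rewrite excess_null // ltnW.
rewrite /excess_between.
pose cnt := \sum_(X : {set T} | (I \subset X) && (X \subset ~: J)) (X \in C).
suff -> : (\sum_(X : {set T} | (I \subset X) && (X \subset ~: J)) excess w b e C X)%R
    = ((ball_size w b e * cnt)%N%:Z - ('C(x + y, x))%:Z)%R.
  move/eqP; rewrite subr_eq0 => /eqP[<-]; exact: dvdn_mulr.
have <- : #|[set X : {set T} | [&& I \subset X, X \subset ~: J & #|X| == w]]| = 'C(x + y, x).
  rewrite card_between //; last by rewrite cI leq_subr.
  rewrite cI; have := cardsC J; rewrite card_T cJ => cJC.
  by congr 'C(_, _); lia.
rewrite /cnt big_distrr /= (big_morph Posz PoszD (erefl _)).
rewrite -sum1_card (big_morph Posz PoszD (erefl _)) -sumrN.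
rewrite [X in (_ + X)%R](eq_bigl (fun X : {set T} =>
    ((I \subset X) && (X \subset ~: J)) && (#|X| == w))); last first.
  by move=> X; rewrite inE andbA.
rewrite [X in (_ + X)%R]big_mkcondr /= -big_split /=; apply: eq_bigr => X _; rewrite /excess.
case: eqP => // cX; rewrite addr0.
case XC: (X \in C); last by rewrite muln0.
by rewrite (perfC.1 X XC) in cX.
Qed.
End DesignStrength.

(** * Steiner systems around a codeword *)

Section Swap.
Variable T : finType.
Implicit Types A B X Y Z : {set T}.

Definition swap X A B := (X :\: A) :|: B.

Lemma card_swap X A B : A \subset X -> B \subset ~: X -> #|A| = #|B| ->
  #|swap X A B| = #|X|.
Proof.
move=> sA sB cAB; rewrite -(cardsID X (swap X A B)) -(cardsID A X) (setIidPr sA) cAB.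
have -> : swap X A B :&: X = X :\: A.
  by rewrite /swap; apply/setP=> x; set_taut x.
have -> : swap X A B :\: X = B.
  by rewrite /swap; apply/setP=> x; set_taut x.
by rewrite addnC.
Qed.

Lemma setC_swap X A B : A \subset X -> B \subset ~: X ->
  ~: swap X A B = swap (~: X) B A.
Proof. by move=> sA sB; rewrite /swap; apply/setP=> x; set_taut x. Qed.

End Swap.

Section LocalStructure.
Variables (T : finType) (w e : nat) (C : {set {set T}}).
Implicit Types A B X Y Z : {set T}.
Hypothesis perfC : perfect w e C.

Lemma perfect_unique X Z Y : X \in C -> Z \in C -> #|Y| = w ->
  #|X :\: Y| <= e -> #|Z :\: Y| <= e -> X = Z.
Proof.
move=> XC ZC cY dXY dZY; have /eqP/cards1P[V eqV] := perfC.2 Y cY.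
have : X \in [set V] by rewrite -eqV inE XC.
have : Z \in [set V] by rewrite -eqV inE ZC.
by rewrite !inE => /eqP-> /eqP->.
Qed.

Lemma perfect_cover Y : #|Y| = w -> exists2 Z, Z \in C & #|Z :\: Y| <= e.
Proof.
move=> cY; have /eqP/cards1P[V eqV] := perfC.2 Y cY.
have : V \in [set V] by rewrite inE.
by rewrite -eqV inE => /andP[VC dV]; exists V.
Qed.

Lemma perfect_nonempty b : #|T| = w + b -> exists X, X \in C.
Proof.
move=> card_T.
have [Y _ cY] : exists2 Y : {set T}, Y \subset [set: T] & #|Y| = w.
  by apply: exists_subset; rewrite cardsT card_T leq_addr.
by have [X XC _] := perfect_cover cY; exists X.
Qed.

Lemma code_setDC X Z : X \in C -> Z \in C -> #|Z :\: X| = #|X :\: Z|.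
Proof. by move=> XC ZC; apply: eq_card_setD; rewrite !perfC.1. Qed.

(** Two closer codewords would both cover a word halfway between them. *)
Lemma perfect_min_dist X Z : X \in C -> Z \in C -> X != Z -> 2 * e < #|X :\: Z|.
Proof.
move=> XC ZC; apply: contraNT; rewrite -leqNgt => le_d; apply/eqP.
have eqd := code_setDC XC ZC.
pose k := minn e #|X :\: Z|.
have [A sA cA] : exists2 A : {set T}, A \subset X :\: Z & #|A| = k.
  by apply: exists_subset; exact: geq_minr.
have [B sB cB] : exists2 B : {set T}, B \subset Z :\: X & #|B| = k.
  by apply: exists_subset; rewrite eqd; exact: geq_minr.
have sAX : A \subset X by apply: subset_trans sA (subsetDl _ _).
have sBX : B \subset ~: X by apply: subset_trans sB _; rewrite setDE subsetIr.
apply: (perfect_unique (Y := swap X A B)) => //.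
- by rewrite card_swap ?cA ?cB // perfC.1.
- have -> : X :\: swap X A B = A.
    by rewrite /swap; apply/setP=> x; set_taut x.
  by rewrite cA geq_minl.
- have -> : Z :\: swap X A B = (Z :\: X) :\: B.
    by rewrite /swap; apply/setP=> x; set_taut x.
  by rewrite cardsD (setIidPr sB) cB eqd /k; lia.
Qed.

Section Neighbours.
Variables X : {set T}.
Hypothesis XC : X \in C.

(** The word obtained from X by exchanging A for B is at distance e + 1 from X,
    so its codeword Z is not X. Since Z is at distance at least 2e + 1 from X
    and at most e from the exchanged word, the triangle inequality is tight,
    and every exchanged element must lie on the way from X to Z. *)
Lemma nearest_exists A B : A \subset X -> B \subset ~: X ->
    #|A| = e.+1 -> #|B| = e.+1 ->
  exists2 Z, Z \in C & [/\ A \subset ~: Z, B \subset Z & #|X :\: Z| = (2 * e).+1].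
Proof.
move=> sA sB cA cB.
have cY : #|swap X A B| = w by rewrite card_swap ?cA ?cB // perfC.1.
have [Z ZC dZY] := perfect_cover cY; exists Z => //.
have dYZ : #|swap X A B :\: Z| <= e by rewrite eq_card_setD // cY perfC.1.
have neqXZ : X != Z.
  apply: contraTneq dZY => <-; rewrite -ltnNge.
  have -> : X :\: swap X A B = A.
    by rewrite /swap; apply/setP=> x; set_taut x.
  by rewrite cA.
have dXZ := perfect_min_dist XC ZC neqXZ.
have dZX := code_setDC XC ZC.
have leX : #|X :\: Z| <= #|A :\: Z| + #|swap X A B :\: Z|.
  apply: leq_trans (leq_card_setU _ _).1; apply: subset_leq_card.
  by rewrite /swap; apply/subsetP=> x; apply/implyP; set_taut x.
have leZ : #|Z :\: X| <= #|B :&: Z| + #|Z :\: swap X A B|.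
  apply: leq_trans (leq_card_setU _ _).1; apply: subset_leq_card.
  by rewrite /swap; apply/subsetP=> x; apply/implyP; set_taut x.
have cAZ : #|A :\: Z| <= #|A| by rewrite subset_leq_card // subsetDl.
have cBZ : #|B :&: Z| <= #|B| by rewrite subset_leq_card // subsetIl.
split; last by lia.
  rewrite -disjoints_subset -setI_eq0 -cards_eq0.
  by have := cardsID Z A; lia.
rewrite -(setIidPl (_ : B \subset Z)) ?subsetIr //.
by apply/setIidPl/eqP; rewrite eqEcard subsetIl; lia.
Qed.

Lemma nearest_unique A B Z Z' : A \subset X -> B \subset ~: X ->
    #|A| = e.+1 -> #|B| = e.+1 -> Z \in C -> Z' \in C ->
    A \subset ~: Z -> B \subset Z -> #|X :\: Z| = (2 * e).+1 ->
    A \subset ~: Z' -> B \subset Z' -> #|X :\: Z'| = (2 * e).+1 ->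
  Z = Z'.
Proof.
move=> sA sB cA cB ZC ZC' sAZ sBZ dZ sAZ' sBZ' dZ'.
have cover V : V \in C -> A \subset ~: V -> B \subset V -> #|X :\: V| = (2 * e).+1 ->
    #|V :\: swap X A B| <= e.
  move=> VC sAV sBV dV.
  have -> : V :\: swap X A B = (V :\: X) :\: B.
    by rewrite /swap; apply/setP=> x; set_taut x.
  rewrite cardsD [(V :\: X) :&: B](_ : _ = B); last by apply/setP=> x; set_taut x.
  by rewrite cB (code_setDC XC VC) dV subSS mul2n -addnn addnK.
apply: (perfect_unique (Y := swap X A B)) => //; try exact: cover.
by rewrite card_swap ?cA ?cB // perfC.1.
Qed.

(** By nearest_exists and nearest_unique, for fixed B the sets X :\: Z, with Z a
    codeword at distance 2e + 1 containing B, form a Steiner system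
    S(e + 1, 2e + 1, w) on X; this is its divisibility condition at I. *)
Lemma steiner_count (B I : {set T}) : B \subset ~: X -> #|B| = e.+1 ->
    I \subset X -> #|I| <= e.+1 ->
  'C((2 * e).+1 - #|I|, e.+1 - #|I|) %| 'C(w - #|I|, e.+1 - #|I|).
Proof.
move=> sB cB sI leI.
pose near Z := [&& Z \in C, #|X :\: Z| == (2 * e).+1 & B \subset Z].
pose S := [set A : {set T} | [&& I \subset A, A \subset X & #|A| == e.+1]].
have <- : #|S| = 'C(w - #|I|, e.+1 - #|I|) by rewrite card_between // perfC.1.
have -> : #|S| = \sum_(A in S) \sum_(Z : {set T} | near Z && (A \subset X :\: Z)) 1.
  rewrite -sum1_card; apply: eq_bigr => A; rewrite inE => /and3P[_ sA /eqP cA].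
  have [Z ZC [sAZ sBZ dZ]] := nearest_exists sA sB cA cB.
  rewrite (big_pred1 Z) // => Z' /=; rewrite /near subsetD sA disjoints_subset /=.
  apply/andP/eqP => [[/and3P[ZC' /eqP dZ' sBZ'] sAZ']|->].
    exact: (nearest_unique sA sB cA cB).
  by rewrite ZC dZ eqxx sBZ.
rewrite (exchange_big_dep (fun Z => near Z && (I \subset X :\: Z))) /=; last first.
  move=> A Z; rewrite inE => /and3P[sIA _ _] /andP[-> sAZ] /=.
  exact: subset_trans sIA sAZ.
rewrite (eq_bigr (fun Z => 'C((2 * e).+1 - #|I|, e.+1 - #|I|))).
  by rewrite sum_nat_const dvdn_mull.
move=> Z /andP[nZ sIZ]; have /and3P[_ /eqP <- _] := nZ.
rewrite -card_between // -sum1_card; apply: eq_bigl => A; rewrite !inE nZ.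
rewrite /= -andbA; case: (I \subset A) => //=.
rewrite andbAC; congr (_ && _).
by apply/andb_idl => sAZ; apply: subset_trans sAZ (subsetDl _ _).
Qed.

End Neighbours.
End LocalStructure.

(** * Words covered on the far side *)

Lemma setCD_C (T : finType) (X Y : {set T}) : ~: X :\: ~: Y = Y :\: X.
Proof. by apply/setP=> x; set_taut x. Qed.

Lemma perfectC (T : finType) w b e (C : {set {set T}}) : #|T| = w + b ->
  perfect w e C -> perfect b e [set ~: X | X in C].
Proof.
move=> card_T perfC; split=> [_ /imsetP[X XC ->]|Y cY].
  by have := cardsC X; rewrite (perfC.1 X XC) card_T; lia.
have cY' : #|~: Y| = w by have := cardsC Y; lia.
rewrite -(perfC.2 _ cY') -[RHS](card_imset _ (can_inj (@setCK T))).
congr #|pred_of_set _|; apply/setP=> X; rewrite inE; apply/andP/imsetP.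
  case=> /imsetP[Z ZC ->] dZ; exists Z => //; rewrite inE ZC /=.
  have eqc : #|Z| = #|~: Y| by rewrite cY' perfC.1.
  by rewrite -(eq_card_setD eqc) -setCD_C setCK.
case=> Z; rewrite inE => /andP[ZC dZ] ->; split; first exact: imset_f.
have eqc : #|Z| = #|~: Y| by rewrite cY' perfC.1.
by rewrite -[Y]setCK setCD_C eq_card_setD.
Qed.

(** The codeword covering the word obtained from X by exchanging x |: A for
    y |: B may keep an element of A or lack an element of B. This is the first
    case; complementation turns it into the second, and uniqueness of the
    covering codeword separates the two. *)
Definition far_side (T : finType) (e : nat) (C : {set {set T}}) (X A B : {set T}) x y :=
  [exists Z in C, [&& #|Z :\: swap X (x |: A) (y |: B)| <= e, B \subset Z
                     & ~~ (A \subset ~: Z)]].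

Section Grid.
Variables (T : finType) (w e : nat) (C : {set {set T}}).
Hypothesis perfC : perfect w e C.
Hypothesis e_gt0 : 0 < e.
Variables X Z0 A B : {set T}.
Hypotheses (XC : X \in C) (Z0C : Z0 \in C).
Hypotheses (sA : A \subset X) (sB : B \subset ~: X).
Hypotheses (cA : #|A| = e.+1) (cB : #|B| = e.+1).
Hypotheses (sAZ0 : A \subset ~: Z0) (sBZ0 : B \subset Z0).
Hypothesis dZ0 : #|X :\: Z0| = (2 * e).+1.

(** For every a in A, the codeword nearest to X in the directions of
    x |: A :\ a and B has e further elements y, and it covers the exchange of
    x |: A for y |: B. The uniqueness of the covering codeword makes these
    (e + 1)e elements y distinct and keeps them off Z0. *)
Lemma far_side_count x : x \in X :&: Z0 ->
  e.+1 * e <= \sum_(y in ~: (X :|: Z0)) far_side e C X A B x y.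
Proof.
rewrite inE => /andP[xX xZ0].
have xA : x \notin A by apply: contraL xZ0 => /(subsetP sAZ0); rewrite inE.
pose A' a := x |: A :\ a.
have sA' a : A' a \subset X.
  by rewrite subUset sub1set xX (subset_trans (subD1set _ _)).
have cA' a : a \in A -> #|A' a| = e.+1.
  move=> aA; rewrite cardsU1 !inE (negPf xA) andbF /= -cA.
  by rewrite [RHS](cardsD1 a) aA.
have [Zs ZsP] : exists Zs : T -> {set T}, forall a, a \in A -> 
   [/\ Zs a \in C, A' a \subset ~: Zs a, B \subset Zs a & #|X :\: Zs a| = (2 * e).+1].
  pose good a Z := [&& Z \in C, A' a \subset ~: Z, B \subset Z & #|X :\: Z| == (2 * e).+1].
  exists (fun a => odflt set0 [pick Z | good a Z]) => a aA.
  case: pickP => [Z /and4P[ZC ? ? /eqP ?] //|none].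
  have [Z ZC [sAZ sBZ dZ]] := nearest_exists perfC XC (sA' a) sB (cA' a aA) cB.
  by have := none Z; rewrite /good ZC sAZ sBZ dZ eqxx.
have xZs a : a \in A -> x \notin Zs a.
  by move=> /ZsP[_ /subsetP/(_ x) sZ _ _]; move: sZ; rewrite !inE eqxx => ->.
have aZs a : a \in A -> a \in Zs a.
  move=> aA; have [ZC sAZ sBZ dZ] := ZsP a aA.
  apply: contraLR (xZs a aA) => aZ; rewrite negbK.
  suff -> : Zs a = Z0 by [].
  apply: (nearest_unique perfC XC sA sB cA cB) => //.
  apply/subsetP=> z zA; have := subsetP sAZ z; rewrite !inE zA andbT.
  by case: (z =P a) => [->|_]; rewrite ?aZ // orbT => ->.
have AZs a a' : a \in A -> a' \in A -> a' != a -> a' \notin Zs a.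
  move=> aA aA' neq; have [_ sAZ _ _] := ZsP a aA.
  by have := subsetP sAZ a'; rewrite !inE neq aA' orbT => ->.
pose Y y := swap X (x |: A) (y |: B).
have cYw y : y \notin X -> y \notin B -> #|Y y| = w.
  move=> yX yB; rewrite card_swap ?(perfC.1 X) //.
  - by rewrite subUset sub1set xX.
  - by rewrite subUset sub1set inE yX.
  - by rewrite !cardsU1 xA yB cA cB.
have cover Z y : Z \in C -> B \subset Z -> y \in Z -> y \notin X -> y \notin B ->
    #|X :\: Z| = (2 * e).+1 -> #|Z :&: (x |: A)| = 1 -> #|Z :\: Y y| <= e.
  move=> ZC sBZ yZ yX yB dZ c1.
  have -> : Z :\: Y y = ((Z :\: X) :\: (y |: B)) :|: (Z :&: (x |: A)).
    have sxA : x |: A \subset X by rewrite subUset sub1set xX.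
    have yxA : (y == x) || (y \in A) = false.
      by apply: contraNF yX => yxA; apply: (subsetP sxA); rewrite !inE.
    apply/setP=> z; rewrite /Y /swap !inE; move: (subsetP sxA z) (subsetP sB z); rewrite !inE.
    case: (z =P y) => [->|_]; rewrite ?(negPf yX) ?(negPf yB) /=.
      by rewrite yxA !andbF /=.
    case: (z \in X) (z \in B) (z \in Z) ((z == x) || (z \in A)) => [] [] [] [] //= h1 h2; 
      by [have := h1 isT | have := h2 isT].
  apply: leq_trans (leq_card_setU _ _).1 _; rewrite c1 cardsD.
  have -> : (Z :\: X) :&: (y |: B) = y |: B.
    apply/setIidPr; rewrite subUset sub1set !inE yZ yX /=.
    by rewrite subsetD sBZ disjoints_subset.
  rewrite cardsU1 yB cB (code_setDC perfC XC ZC) dZ.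
  by clear -e_gt0; lia.
pose W a := (Zs a :\: X) :\: B.
have cW a : a \in A -> #|W a| = e.
  move=> aA; have [ZC _ sBZ dZ] := ZsP a aA.
  rewrite cardsD (setIidPr _); last by rewrite subsetD sBZ disjoints_subset.
  by rewrite cB (code_setDC perfC XC ZC) dZ subSS mul2n -addnn addnK.
have coverW a y : a \in A -> y \in W a -> #|Zs a :\: Y y| <= e.
  move=> aA; rewrite !inE => /and3P[yB yX yZ]; have [ZC _ sBZ dZ] := ZsP a aA.
  apply: cover => //; apply/eqP/cards1P; exists a; apply/setP=> z; rewrite !inE.
  case: (z =P a) => [->|/eqP neq]; first by rewrite aZs // aA orbT.
  case: (z =P x) => [->|_] /=; first by rewrite (negPf (xZs a aA)).
  by case zA: (z \in A); rewrite ?andbF // (negPf (AZs a z aA zA neq)).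
have WZ0 a y : a \in A -> y \in W a -> y \notin Z0.
  move=> aA yW; have := yW; rewrite !inE => /and3P[yB yX yZ].
  have [ZC _ sBZ dZ] := ZsP a aA.
  apply/negP=> yZ0; move: (xZs a aA); suff -> : Zs a = Z0 by rewrite xZ0.
  apply: (perfect_unique perfC ZC Z0C (cYw y yX yB)); first exact: coverW.
  apply: cover => //; apply/eqP/cards1P; exists x; apply/setP=> z; rewrite !inE.
  case: (z =P x) => [->|_] /=; first by rewrite xZ0.
  by have := subsetP sAZ0 z; rewrite inE; case: (z \in A) => [/(_ isT)/negPf->|_]; rewrite ?andbF.
have disjW a a' y : a \in A -> a' \in A -> y \in W a -> y \in W a' -> a = a'.
  move=> aA aA' yW yW'; apply/eqP/negPn/negP=> neq.
  have := yW; rewrite !inE => /and3P[yB yX _].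
  have eqZ : Zs a = Zs a'.
    apply: (perfect_unique perfC (Y := Y y)); rewrite ?cYw ?coverW //.
      by case: (ZsP a aA).
    by case: (ZsP a' aA').
  by have := AZs a' a aA' aA neq; rewrite -eqZ aZs.
have <- : \sum_(a in A) #|W a| = e.+1 * e.
  by rewrite (eq_bigr (fun=> e)) ?sum_nat_const ?cA.
have -> : \sum_(a in A) #|W a| = \sum_(a in A) \sum_(y in ~: (X :|: Z0)) (y \in W a).
  apply: eq_bigr => a aA; rewrite -sum1_card big_mkcond [RHS]big_mkcond /=.
  apply: eq_bigr => y _; case yW: (y \in W a); last by case: ifP.
  have := WZ0 a y aA yW; move: yW; rewrite !inE => /and3P[_ yX _] yZ0.
  by rewrite negb_or yX yZ0.
rewrite exchange_big /=; apply: leq_sum => y; rewrite !inE negb_or => /andP[yX yZ0].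
case: (pickP (fun a => (a \in A) && (y \in W a))) => [a /andP[aA yW]|none]; last first.
  by rewrite big1 // => a aA; have := none a; rewrite aA /= => ->.
rewrite (bigD1 a) //= yW big1 => [|a' /andP[aA' neq]]; last first.
  by case yW': (y \in W a') => //; rewrite (disjW a a' y) ?eqxx in neq.
rewrite addn0 lt0b; apply/existsP; exists (Zs a); have [ZC _ sBZ dZ] := ZsP a aA.
rewrite ZC sBZ coverW //=; apply/negP=> /subsetP/(_ a aA); rewrite inE.
by rewrite aZs.
Qed.

End Grid.

(** * Bounds on the weight *)

Lemma far_side_excl (T : finType) w b e (C : {set {set T}}) (X A B : {set T}) x y :
    #|T| = w + b -> perfect w e C -> X \in C ->
    x |: A \subset X -> y |: B \subset ~: X -> #|x |: A| = #|y |: B| ->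
  far_side e C X A B x y + far_side e [set ~: Z | Z in C] (~: X) B A y x <= 1.
Proof.
move=> card_T perfC XC sA sB cAB.
have cY : #|swap X (x |: A) (y |: B)| = w by rewrite card_swap ?(perfC.1 X).
case: (boolP (far_side e C X A B x y)) => [/existsP[Z]|_]; last by case: far_side.
case/and4P=> ZC dZ sBZ _; suff -> : far_side e [set ~: V | V in C] (~: X) B A y x = false.
  by rewrite addn0 leq_b1.
apply/negbTE/existsP=> -[V /and4P[/imsetP[Z' ZC' ->{V}] dZ' _]].
rewrite setCK => /negP[].
rewrite -setC_swap // setCD_C -eq_card_setD ?cY ?(perfC.1 Z') // in dZ'.
by rewrite -(perfect_unique perfC ZC ZC' cY dZ dZ').
Qed.

(** Fix codewords X and Z at distance 2e + 1 and sets A, B of e + 1 elements on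
    the way. Of the pairs (x, y) with x in both X and Z and y in neither, every x has
    at least (e + 1)e on the far side of A by far_side_count, and every y as many
    on the far side of B by the same lemma for the complementary code. No pair
    is of both kinds. *)
Lemma grid_bound (T : finType) w b e (C : {set {set T}}) :
    #|T| = w + b -> perfect w e C -> 0 < e -> e < w -> e < b ->
  [/\ (2 * e).+1 <= w, (2 * e).+1 <= b &
    e.+1 * e * ((w - (2 * e).+1) + (b - (2 * e).+1))
      <= (w - (2 * e).+1) * (b - (2 * e).+1)].
Proof.
move=> card_T perfC e_gt0 lt_ew lt_eb.
have [X XC] := perfect_nonempty perfC card_T.
have cX := perfC.1 X XC; have cXC : #|~: X| = b by have := cardsC X; lia.
have [A sA cA] : exists2 A : {set T}, A \subset X & #|A| = e.+1.
  by apply: exists_subset; rewrite cX.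
have [B sB cB] : exists2 B : {set T}, B \subset ~: X & #|B| = e.+1.
  by apply: exists_subset; rewrite cXC.
have [Z ZC [sAZ sBZ dZ]] := nearest_exists perfC XC sA sB cA cB.
have dZX : #|Z :\: X| = (2 * e).+1 by rewrite (code_setDC perfC XC ZC).
have cR : #|X :&: Z| = w - (2 * e).+1.
  by rewrite -cX -(cardsID Z X) dZ addnK.
have eqQ : ~: X :&: ~: Z = ~: (X :|: Z) by rewrite setCU.
have cQ : #|~: (X :|: Z)| = b - (2 * e).+1.
  by rewrite -eqQ -setDE -cXC -(cardsID Z (~: X)) setIC -setDE dZX addKn.
split.
- by rewrite -dZ -cX subset_leq_card ?subsetDl.
- by rewrite -dZX -cXC subset_leq_card // setDE subsetIr.
have perfCC := perfectC card_T perfC.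
rewrite mulnC mulnDl -cR -cQ.
pose C' := [set ~: V | V in C].
apply: (@leq_trans (\sum_(x in X :&: Z) \sum_(y in ~: (X :|: Z))
    (far_side e C X A B x y + far_side e C' (~: X) B A y x))).
  under eq_bigr => x _ do rewrite big_split /=.
  rewrite big_split /= leq_add //.
    rewrite -sum_nat_const; apply: leq_sum => x xR.
    exact: (@far_side_count _ w e C perfC e_gt0 X Z A B).
  rewrite exchange_big /= -sum_nat_const; apply: leq_sum => y yQ.
  have -> : X :&: Z = ~: (~: X :|: ~: Z) by rewrite setCU !setCK.
  apply: (@far_side_count _ b e C' perfCC e_gt0 (~: X) (~: Z) B A) => //.
  - exact: imset_f.
  - exact: imset_f.
  - by rewrite setCK.
  - by rewrite setCK.
  - by rewrite setCD_C.
  - by rewrite eqQ.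
rewrite -sum_nat_const; apply: leq_sum => x; rewrite inE => /andP[xX xZ].
rewrite -sum1_card; apply: leq_sum => y; rewrite !inE negb_or => /andP[yX yZ].
apply: (far_side_excl card_T perfC XC).
- by rewrite subUset sub1set xX.
- by rewrite subUset sub1set inE yX.
have xA : x \notin A by apply: contraL xZ => /(subsetP sAZ); rewrite inE.
have yB : y \notin B by apply: contra yZ; apply: subsetP.
by rewrite !cardsU1 xA yB cA cB.
Qed.

Lemma card_pieces (T : finType) (X : {set T}) a c :
  #|[set S : {set T} | (#|S :&: X| == a) && (#|S :\: X| == c)]|
    = 'C(#|X|, a) * 'C(#|~: X|, c).
Proof.
rewrite -!cards_draws -cardsX -[RHS](card_in_imset (f := fun S => S.1 :|: S.2)).
  congr #|pred_of_set _|; apply/setP=> S; rewrite inE; apply/andP/imsetP.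
    case=> cI cD; exists (S :&: X, S :\: X); last by rewrite /= setID.
    by rewrite !inE /= cI cD subsetIr setDE subsetIr.
  case=> [[U V]]; rewrite !inE /= => /andP[/andP[sU cU] /andP[sV cV]] ->.
  have -> : (U :|: V) :&: X = U by apply/setP=> x; set_taut x.
  by have -> : (U :|: V) :\: X = V by apply/setP=> x; set_taut x.
move=> [U V] [U' V']; rewrite !inE /= => /andP[/andP[sU _] /andP[sV _]].
move=> /andP[/andP[sU' _] /andP[sV' _]] eqUV.
by congr (_, _); apply/setP=> x; move/setP/(_ x): eqUV; set_taut x.
Qed.

(** Let S have u elements, let X be S with two more elements, and let e = f + 1.
    The left sum counts the words missing at most e elements of X, the right sum
    those missing at most e - 1 elements of S. They differ by the
    words missing e elements of S and neither of the two others, and the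
    words missing e - 1 elements of S and both others. *)
Lemma bin_exchange u b f :
  \sum_(i < f.+2) 'C(u.+2, i) * 'C(b, i) + 'C(u, f) * 'C(b, f.+2)
    = \sum_(l < f.+1) 'C(u, l) * 'C(b.+2, l.+2) + 'C(u, f.+1) * 'C(b, f.+1).
Proof.
elim: f => [|f IHf].
  by rewrite big_ord_recr !big_ord1 /= !binS !bin0 !bin1; ring.
rewrite big_ord_recr [in RHS]big_ord_recr /=.
apply: (@addIn ('C(u, f) * 'C(b, f.+2))).
rewrite [LHS]addnAC [X in X + _ = _]addnAC IHf !binS; ring.
Qed.

(** A perfect code makes the ball the largest set of diameter 2e. It is compared
    here with the set of words having all but at most e - 1 elements of a
    (w - 2)-set S: every such set contains at most one codeword, and averaging
    over S bounds its size by that of the ball. The weight and the radius are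
    written w + 2 and e + 1 to avoid subtractions. *)
Lemma anticode_bound (T : finType) w b e (C : {set {set T}}) :
    #|T| = w.+2 + b -> perfect w.+2 e.+1 C ->
  \sum_(l < e.+1) 'C(w, l) * 'C(b.+2, l.+2) <= ball_size w.+2 b e.+1.
Proof.
move=> card_T perfC.
pose M := \sum_(l < e.+1) 'C(w.+2, l.+2) * 'C(b, l).
have card_C : #|C| * ball_size w.+2 b e.+1 = 'C(w.+2 + b, w.+2).
  rewrite -card_T -cardsT -cards_draws -sum_nat_const.
  transitivity (\sum_(X in C) \sum_(Y : {set T} | (#|Y| == w.+2) && (#|X :\: Y| <= e.+1)) 1).
    apply: eq_bigr => X XC; rewrite -(card_ball e.+1 card_T (perfC.1 X XC)) -sum1_card.
    apply: eq_bigl => Y; rewrite inE; apply: andb_id2l => /eqP cY.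
    by rewrite -eq_card_setD // cY perfC.1.
  rewrite (exchange_big_dep (fun Y : {set T} => #|Y| == w.+2)) /=; last by move=> ? ? _ /andP[].
  rewrite -sum1_card; apply: eq_big => Y; first by rewrite inE subsetT.
  move=> cY; rewrite -[RHS](perfC.2 Y (eqP cY)) -[RHS]sum1_card; apply: eq_bigl => X.
  by rewrite inE cY.
have packing : #|C| * M <= 'C(w.+2 + b, w).
  rewrite -card_T -cardsT -cards_draws -sum_nat_const.
  apply: (@leq_trans (\sum_(X in C) \sum_(S : {set T} | (#|S| == w) && (#|S :\: X| <= e)) 1)).
    apply: leq_sum => X XC; rewrite sum1dep_card.
    rewrite (card_le_sum (fun S : {set T} => #|S| == w) (fun S : {set T} => #|S :\: X|)).
    apply: leq_sum => l _.
    have cX := perfC.1 X XC.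
    have cXC : #|~: X| = b by have := cardsC X; lia.
    have [lelw|ltwl] := leqP l w; last by rewrite bin_small // ltnS.
    rewrite -(bin_sub (_ : l.+2 <= w.+2)) // !subSS -{1}cX -cXC -card_pieces.
    apply: subset_leq_card; apply/subsetP=> S; rewrite !inE => /andP[/eqP cI /eqP cD].
    by rewrite -(cardsID X S) cI cD subnK ?eqxx.
  rewrite (exchange_big_dep (fun S : {set T} => #|S| == w)) /=; last by move=> ? ? _ /andP[].
  rewrite -sum1_card [leqRHS](eq_bigl (fun S : {set T} => #|S| == w)); last first.
    by move=> S; rewrite inE subsetT.
  apply: leq_sum => S /eqP cS; rewrite sum1dep_card.
  apply/card_le1P => X; rewrite inE => /and3P[XC _ dX] X'; rewrite !inE.
  apply/and3P/eqP => [[XC' _ dX']|->]; last by rewrite XC cS eqxx.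
  apply/eqP/negPn/negP; rewrite eq_sym => neq.
  have := perfect_min_dist perfC XC XC' neq.
  have cX := perfC.1 X XC.
  have := cardsID X' X; have := cardsID X S.
  have : #|S :&: X| <= #|X :&: X'| + #|S :\: X'|.
    apply: leq_trans (leq_card_setU _ _).1; apply: subset_leq_card.
    by apply/subsetP=> x; apply/implyP; set_taut x.
  rewrite cX cS; clear -dX dX'; lia.
have binC : 'C(w.+2 + b, w) * (b.+2 * b.+1) = 'C(w.+2 + b, w.+2) * (w.+2 * w.+1).
  have := mul_bin_left (w.+2 + b) w; have := mul_bin_left (w.+2 + b) w.+1.
  have -> : w.+2 + b - w = b.+2 by lia.
  have -> : w.+2 + b - w.+1 = b.+1 by lia.
  move=> h1 h2; transitivity (b.+1 * (b.+2 * 'C(w.+2 + b, w))); first by ring.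
  rewrite -h2; transitivity (w.+1 * (b.+1 * 'C(w.+2 + b, w.+1))); first by ring.
  by rewrite -h1; ring.
have eqM : M * (b.+2 * b.+1) = \sum_(l < e.+1) 'C(w, l) * 'C(b.+2, l.+2) * (w.+2 * w.+1).
  rewrite big_distrl /=; apply: eq_bigr => l _.
  have h1 := mul_bin_diag w.+2 l.+1; have h2 := mul_bin_diag w.+1 l.
  have h3 := mul_bin_diag b.+2 l.+1; have h4 := mul_bin_diag b.+1 l.
  rewrite /= in h1 h2 h3 h4.
  apply/eqP; rewrite -(@eqn_pmul2r (l.+2 * l.+1)) //; apply/eqP.
  transitivity (l.+1 * (l.+2 * 'C(w.+2, l.+2)) * (b.+2 * (b.+1 * 'C(b, l)))); first by ring.
  rewrite -h1 h4; transitivity (w.+2 * (l.+1 * 'C(w.+1, l.+1))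
    * (l.+1 * (b.+2 * 'C(b.+1, l.+1)))); first by ring.
  by rewrite -h2 h3; ring.
have C_gt0 : 0 < #|C|.
  by have := bin_gt0 (w.+2 + b) w.+2; rewrite -card_C leq_addr muln_gt0 => /andP[].
rewrite -(@leq_pmul2r (w.+2 * w.+1)) // big_distrl /= -eqM.
rewrite -(leq_pmul2l C_gt0) !mulnA card_C -!mulnA -binC !mulnA.
by rewrite -[_ * b.+2 * b.+1]mulnA -[X in _ <= X]mulnA leq_mul2r packing orbT.
Qed.

(** The bound of Roos. By bin_exchange, anticode_bound says that the words of
    the ball outside the other set are at least as many as those of the other
    set outside the ball. *)
Lemma roos_bound (T : finType) w b e (C : {set {set T}}) :
    #|T| = w + b -> perfect w e C -> 0 < e -> e < w -> e < b ->
  e * (b - e) <= e.+1 * (w - e.+1).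
Proof.
case: e => // e; case: w => [|[|w]] // card_T perfC _ lt_ew lt_eb.
have le_terms : 'C(w, e) * 'C(b, e.+2) <= 'C(w, e.+1) * 'C(b, e.+1).
  have := anticode_bound card_T perfC; rewrite /ball_size.
  have := bin_exchange w b e; clear; lia.
have hw := mul_bin_left w e; have hb := mul_bin_left b e.+1.
have Q_gt0 : 0 < 'C(w, e) * 'C(b, e.+1).
  by rewrite muln_gt0 !bin_gt0; lia.
rewrite -(leq_pmul2l Q_gt0) !subSS.
have -> : 'C(w, e) * 'C(b, e.+1) * (e.+1 * (b - e.+1))
    = e.+2 * e.+1 * ('C(w, e) * 'C(b, e.+2)).
  transitivity (e.+1 * 'C(w, e) * ((b - e.+1) * 'C(b, e.+1))); first by ring.
  by rewrite -hb; ring.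
have -> : 'C(w, e) * 'C(b, e.+1) * (e.+2 * (w - e))
    = e.+2 * e.+1 * ('C(w, e.+1) * 'C(b, e.+1)).
  transitivity (e.+2 * 'C(b, e.+1) * ((w - e) * 'C(w, e))); first by ring.
  by rewrite -hw; ring.
by rewrite leq_mul2l le_terms orbT.
Qed.

Lemma steiner_dvd (T : finType) w b e s (C : {set {set T}}) :
    #|T| = w + b -> perfect w e C -> e < w -> e < b -> s <= e.+1 ->
  'C(e + s, s) %| 'C(w - e.+1 + s, s).
Proof.
move=> card_T perfC lt_ew lt_eb le_se.
have [X XC] := perfect_nonempty perfC card_T.
have cX := perfC.1 X XC; have cXC : #|~: X| = b by have := cardsC X; lia.
have [I sI cI] : exists2 I : {set T}, I \subset X & #|I| = e.+1 - s.
  by apply: exists_subset; rewrite cX; lia.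
have [B sB cB] : exists2 B : {set T}, B \subset ~: X & #|B| = e.+1.
  by apply: exists_subset; rewrite cXC.
have := steiner_count perfC XC sB cB sI; rewrite cI leq_subr subKn // => /(_ isT).
have -> : (2 * e).+1 - (e.+1 - s) = e + s by clear -le_se; lia.
by have -> : w - (e.+1 - s) = w - e.+1 + s by clear -le_se lt_ew; lia.
Qed.

(** With P = w - 2e - 1 and Q = b - 2e - 1, grid_bound reads
    PQ >= e(e + 1)(P + Q), and roos_bound gives eQ <= (e + 1)P. Unless P and Q
    vanish, these yield P >= 2e^2 + e, which the divisibility of P by e + 1
    improves to 2e^2 + 2e. *)
Lemma perfect_lower_bound (T : finType) w b e (C : {set {set T}}) :
    #|T| = w + b -> perfect w e C -> 0 < e -> e < w -> w <= b ->
  [\/ w = 2 * e + 1 /\ b = 2 * e + 1 | 2 * e ^ 2 + 4 * e + 1 <= w].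
Proof.
move=> card_T perfC e_gt0 lt_ew le_wb; have lt_eb := leq_trans lt_ew le_wb.
have [le_w le_b grid] := grid_bound card_T perfC e_gt0 lt_ew lt_eb.
have roos := roos_bound card_T perfC e_gt0 lt_ew lt_eb.
have dvd_w : e.+1 %| w - e.
  have := steiner_dvd card_T perfC lt_ew lt_eb (isT : 1 <= e.+1).
  by rewrite !bin1 addn1 addn1 subnSK.
clear -grid roos dvd_w e_gt0 le_w le_b le_wb.
have [P eqP] : exists P, w = P + (2 * e).+1 by exists (w - (2 * e).+1); lia.
have [Q eqQ] : exists Q, b = Q + (2 * e).+1 by exists (b - (2 * e).+1); lia.
have le_PQ : P <= Q by lia.
rewrite eqP eqQ !addnK in grid.
have {}roos : e * Q <= e.+1 * P.
  have eb : b - e = Q + e.+1 by lia.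
  have ew : w - e.+1 = P + e by lia.
  by move: roos; rewrite eb ew; nia.
have dvd_P : e.+1 %| P.
  have eqw : w - e = P + e.+1 by lia.
  by move: dvd_w; rewrite eqw dvdn_addl ?dvdnn.
clear dvd_w; have [P0|P_gt0] := posnP P; [left|right].
  by move: grid; rewrite P0 mul0n; nia.
have gt_P : e.+1 * e < P.
  by rewrite ltnNge; apply/negP=> leP; nia.
have ge_P : e.+1 * e + e ^ 2 <= P by nia.
have [p eqp] := dvdnP dvd_P.
have : 2 * e <= p by rewrite leqNgt; apply/negP=> ltp; nia.
by rewrite eqP; nia.
Qed.

(** * Divisibility of the ball size by the square of a prime *)

(** Adding x and y in base p produces a carry out of the k lowest digits. *)
Definition carry p k x y := p ^ k <= x %% p ^ k + y %% p ^ k.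

Lemma logn_fact_wide p n N : prime p -> n <= N ->
  logn p n`! = \sum_(1 <= k < N.+1) n %/ p ^ k.
Proof.
move=> pr_p le_nN; rewrite logn_fact // (@big_cat_nat _ _ _ n.+1 1 N.+1) //=.
rewrite [X in _ = _ + X]big_nat_cond [X in _ = _ + X]big1 ?addn0 // => k.
rewrite andbT => /andP[lt_nk _]; apply: divn_small.
by apply: leq_trans lt_nk (ltnW (ltn_expl _ (prime_gt1 pr_p))).
Qed.

(** Kummer's theorem, from Legendre's formula for the valuation of a factorial.
    The powers of p beyond the N-th exceed x + y, and there is no carry there. *)
Lemma kummer p x y N : prime p -> x + y <= N ->
  logn p 'C(x + y, x) = \sum_(1 <= k < N.+1) carry p k x y.
Proof.
move=> pr_p le_N.
apply: (@addIn (logn p (x`! * y`!))).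
rewrite -lognM ?bin_gt0 ?leq_addr ?muln_gt0 ?fact_gt0 //.
rewrite -{2}(addKn x y) bin_fact ?leq_addr // lognM ?fact_gt0 //.
rewrite !(@logn_fact_wide p _ N) //; try lia.
rewrite -!big_split; apply: eq_bigr => k _ /=.
by rewrite divnD ?expn_gt0 ?prime_gt0 // addnC.
Qed.

Lemma carry_dvd p k x y : prime p -> 0 < k -> carry p k x y -> p %| 'C(x + y, x).
Proof.
move=> pr_p k_gt0 ck; rewrite -[p]expn1 pfactor_dvdn ?bin_gt0 ?leq_addr //.
rewrite (@kummer p x y (x + y + k)) ?leq_addr //.
by rewrite (bigD1_seq k) ?iota_uniq ?mem_index_iota //= ?ck //; lia.
Qed.

Lemma two_carries_dvd p j k x y : prime p -> 0 < j < k -> carry p j x y -> carry p k x y ->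
  p ^ 2 %| 'C(x + y, x).
Proof.
move=> pr_p /andP[j_gt0 lt_jk] cj ck; rewrite pfactor_dvdn ?bin_gt0 ?leq_addr //.
rewrite (@kummer p x y (x + y + k)) ?leq_addr //.
rewrite (bigD1_seq j) ?iota_uniq ?mem_index_iota //= ?cj //; last by lia.
rewrite -big_filter (bigD1_seq k) ?filter_uniq ?iota_uniq // ?mem_filter ?mem_index_iota /=.
  by rewrite ck.
by lia.
Qed.

Section BallSizeValuation.
Variable p : nat.
Hypothesis pr_p : prime p.

(** From l C(N, l) = N C(N - 1, l - 1): the factors p of N = p ^ 3 m that are
    not in l must be in the binomial coefficient. *)
Lemma dvd_bin_mul_pow m l k : k < 3 -> ~~ (p ^ k.+1 %| l) ->
  p ^ (3 - k) %| 'C(p ^ 3 * m, l).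
Proof.
move=> lt_k3; case: l => [|l]; first by rewrite dvdn0.
move=> ndvd; have [->|C_gt0] := posnP 'C(p ^ 3 * m, l.+1); first exact: dvdn0.
have : p ^ 3 %| l.+1 * 'C(p ^ 3 * m, l.+1).
  by rewrite -mul_bin_diag -mulnA dvdn_mulr.
rewrite !pfactor_dvdn ?muln_gt0 // in ndvd *; rewrite lognM //; lia.
Qed.

(** The truncation at e is invisible, because the first factor already
    vanishes beyond l + r. *)
Lemma shifted_Vandermonde r r' l l' e : l + r <= e ->
  \sum_(i < e.+1) (l <= i) * 'C(r, i - l) * ((l' <= i) * 'C(r', i - l'))
    = (l' <= l + r) * 'C(r' + r, l + r - l').
Proof.
move=> le_e.
have termE i : (l <= i) * 'C(r, i - l) * ((l' <= i) * 'C(r', i - l'))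
    = (i <= l + r) * ((l' <= i) * ('C(r', i - l') * 'C(r, l + r - i))).
  have [le_i|lt_i] := leqP i (l + r); last first.
    by rewrite [X in _ * X * _]bin_small ?muln0 ?mul0n //; lia.
  have [le_li|lt_il] := leqP l i; last first.
    by rewrite [X in _ = _ * (_ * (_ * X))]bin_small ?muln0 ?mul0n //; lia.
  have -> : l + r - i = r - (i - l) by lia.
  by rewrite bin_sub; [ring | lia].
under eq_bigr => i _ do rewrite termE.
rewrite -(big_mkord predT (fun i =>
  (i <= l + r) * ((l' <= i) * ('C(r', i - l') * 'C(r, l + r - i))))).
rewrite (@big_cat_nat _ _ _ (l + r).+1) //=.
rewrite [X in _ + X]big_nat_cond [X in _ + X]big1 ?addn0; last first.
  by move=> i; rewrite andbT => /andP[lt_i _]; rewrite leqNgt lt_i mul0n.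
have [le_l'|lt_l'] := leqP l' (l + r); last first.
  rewrite mul0n big_nat_cond big1 // => i; rewrite andbT => /andP[_ le_i].
  by rewrite [l' <= i]leqNgt (leq_trans le_i lt_l') mul0n muln0.
rewrite mul1n (@big_cat_nat _ _ _ l') //=; last by rewrite leqW.
rewrite big_nat_cond big1 ?add0n; last first.
  by move=> i; rewrite andbT => /andP[_ lt_i]; rewrite [l' <= i]leqNgt lt_i mul0n muln0.
rewrite -binomial.Vandermonde -{1}[l']add0n big_addn subSn // big_mkord.
apply: eq_bigr => u _; have lt_u := ltn_ord u.
have -> : u + l' <= l + r by lia.
rewrite leq_addl !mul1n addnK; congr (_ * 'C(_, _)); lia.
Qed.

Variables w b e : nat.
Let q := p ^ 3.
Let r := w %% q.
Let r' := b %% q.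
Hypotheses (le_re : r <= e %% q) (le_re' : r' <= e %% q).
Hypothesis high_carry : carry p 3 r r'.
Hypothesis low_carry : carry p 1 r r' || carry p 2 r r'.

Lemma q_gt0 : 0 < q. Proof. by rewrite expn_gt0 prime_gt0. Qed.

Lemma multiple_low l : q %| l -> l <= e -> forall s, s <= e %% q -> l + s <= e.
Proof.
move=> /dvdnP[m ->] le_e s le_s.
have : m <= e %/ q by rewrite leq_divRL // q_gt0.
move=> le_m; rewrite [leqRHS](divn_eq e q); apply: leq_add => //.
by rewrite leq_mul2r le_m orbT.
Qed.

(** N differs from r by a multiple of p ^ 2, so that adding N and its
    complement r + r' - N produces the same carries out of the two lowest
    digits as adding r and r'. *)
Lemma low_bin_dvd N l l' : p ^ 2 %| l -> p ^ 2 %| l' -> N + l' = r + l -> p %| 'C(r + r', N).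
Proof.
move=> dl dl' eqN; have [lt_N|le_N] := ltnP (r + r') N.
  by rewrite bin_small ?dvdn0.
have [y eqy] : exists y, r + r' = N + y by exists (r + r' - N); rewrite subnKC.
have same_mod k u v : k <= 2 -> u + l' = v + l -> u %% p ^ k = v %% p ^ k.
  move=> le_k eq_uv; have dk := dvdn_exp2l p le_k.
  have /eqP ml := dvdn_trans dk dl; have /eqP ml' := dvdn_trans dk dl'.
  by rewrite -[u]addn0 -ml' modnDmr eq_uv -modnDmr ml addn0.
have modN k : k <= 2 -> N %% p ^ k = r %% p ^ k by move/same_mod; apply.
have mody k : k <= 2 -> y %% p ^ k = r' %% p ^ k.
  by move=> le_k; apply/esym/same_mod => //; clear -eqN eqy; lia.
rewrite eqy; have [c1|c2] := orP low_carry.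
  by apply: (@carry_dvd p 1) => //; rewrite /carry modN ?mody.
by apply: (@carry_dvd p 2) => //; rewrite /carry modN ?mody.
Qed.

(** By shifted_Vandermonde the sum is a binomial coefficient of r + r'. If q
    divides l', only l = l' leaves it nonzero, and both carries are
    available; otherwise the first factor contributes one p and the low carry
    the other. *)
Lemma shifted_sum_dvd l l' : q %| l -> l <= e -> p ^ 2 %| l' ->
  p ^ 2 %| 'C(q * (b %/ q), l')
    * \sum_(i < e.+1) (l <= i) * 'C(r, i - l) * ((l' <= i) * 'C(r', i - l')).
Proof.
move=> dl le_le dl'; rewrite shifted_Vandermonde; last exact: multiple_low.
have [le_l'|_] := leqP l' (l + r); last by rewrite mul0n muln0 dvdn0.
have lt_r : r < q by rewrite ltn_mod q_gt0.
have lt_r' : r' < q by rewrite ltn_mod q_gt0.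
have dl2 : p ^ 2 %| l by apply: dvdn_trans dl; rewrite dvdn_exp2l.
rewrite mul1n (addnC r' r); case: (boolP (q %| l')) => [dl'q|ndl'].
  have [m el] := dvdnP dl; have [m' el'] := dvdnP dl'q.
  have [lt_m|lt_m|eq_m] := ltngtP m m'.
  - have : m.+1 * q <= m' * q by rewrite leq_mul2r lt_m orbT.
    by move: le_l'; rewrite el el' mulSn; clear -lt_r; lia.
  - have : m'.+1 * q <= m * q by rewrite leq_mul2r lt_m orbT.
    rewrite mulSn => le_m; rewrite dvdn_mull // bin_small ?dvdn0 //.
    by rewrite el el'; clear -lt_r' le_m; lia.
  - rewrite el el' eq_m addKn dvdn_mull //.
    have [c1|c2] := orP low_carry.
      exact: (@two_carries_dvd p 1 3).
    exact: (@two_carries_dvd p 2 3).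
rewrite expnS expn1 dvdn_mul //.
  by have := @dvd_bin_mul_pow (b %/ q) l' 2 isT ndl'; rewrite expn1.
by apply: (low_bin_dvd dl2 dl'); rewrite subnK // addnC.
Qed.

End BallSizeValuation.

Lemma carryC p k x y : carry p k x y = carry p k y x.
Proof. by rewrite /carry addnC. Qed.

Lemma bin_split q r m e i : i <= e ->
  'C(q * m + r, i) = \sum_(l < e.+1) 'C(q * m, l) * ((l <= i) * 'C(r, i - l)).
Proof.
move=> le_ie; rewrite -binomial.Vandermonde.
rewrite (big_ord_widen e.+1 (fun l => 'C(q * m, l) * 'C(r, i - l))) //.
rewrite big_mkcond /=; apply: eq_bigr => l _; rewrite ltnS.
by case: leqP => _; rewrite ?mul1n // mul0n muln0.
Qed.

(** Vandermonde splits the binomials of w and b into those of the multiples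
    of q, at l and l', and those of the residues r and r'. The former are
    divisible by p unless q divides the lower index, and by p ^ 2 unless p ^ 2
    divides it. What is left is shifted_sum_dvd and its mirror image. *)
Lemma sq_dvd_ball_size p w b e (q := p ^ 3) (r := w %% q) (r' := b %% q) :
    prime p -> r <= e %% q -> r' <= e %% q -> carry p 3 r r' ->
    carry p 1 r r' || carry p 2 r r' ->
  p ^ 2 %| ball_size w b e.
Proof.
move=> pr_p le_r le_r' high low.
have -> : ball_size w b e = \sum_(l < e.+1) \sum_(l' < e.+1)
    'C(q * (w %/ q), l) * 'C(q * (b %/ q), l')
    * \sum_(i < e.+1) (l <= i) * 'C(r, i - l) * ((l' <= i) * 'C(r', i - l')).
  under [RHS]eq_bigr => l _ do under eq_bigr => l' _ do rewrite big_distrr /=.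
  under [RHS]eq_bigr => l _ do rewrite exchange_big /=.
  rewrite [RHS]exchange_big /=; apply: eq_bigr => i _.
  rewrite [in LHS](divn_eq w q) [in LHS](divn_eq b q) ![_ %/ q * q]mulnC.
  rewrite -/r -/r'.
  have le_i : i <= e by rewrite -ltnS.
  rewrite (bin_split q r _ le_i) (bin_split q r' _ le_i) big_distrl /=; apply: eq_bigr => l _.
  by rewrite big_distrr /=; apply: eq_bigr => l' _; ring.
apply: dvdn_sum => l _; apply: dvdn_sum => l' _.
have le_l := leq_ord l; have le_l' := leq_ord l'.
case: (boolP (p ^ 2 %| l)) => [dl|ndl]; last first.
  by rewrite -mulnA dvdn_mulr // (@dvd_bin_mul_pow p pr_p _ l 1).
case: (boolP (p ^ 2 %| l')) => [dl'|ndl']; last first.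
  by rewrite mulnAC dvdn_mull // (@dvd_bin_mul_pow p pr_p _ l' 1).
case: (boolP (q %| l)) => [qdl|qndl].
  by rewrite -mulnA dvdn_mull // shifted_sum_dvd.
case: (boolP (q %| l')) => [qdl'|qndl'].
  rewrite -mulnA mulnCA dvdn_mull //.
  under eq_bigr => i _ do rewrite mulnC.
  apply: shifted_sum_dvd => //; first by rewrite carryC.
  by rewrite carryC [carry p 2 _ _]carryC.
rewrite dvdn_mulr // expnS expn1 dvdn_mul //.
  by have := @dvd_bin_mul_pow p pr_p (w %/ q) l 2 isT qndl; rewrite expn1.
by have := @dvd_bin_mul_pow p pr_p (b %/ q) l' 2 isT qndl'; rewrite expn1.
Qed.

(** * Arithmetic in base 3 *)

Lemma bin_dvd_ffact m n s : 'C(m, s) %| 'C(n, s) -> m ^_ s %| n ^_ s.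
Proof. by move=> dvd; rewrite -!bin_ffact dvdn_pmul2r ?fact_gt0. Qed.

(** 27 divides e + 2, hence the product of the consecutive numbers w - e + 1
    and w - e, of which only one can be a multiple of 3. *)
Lemma steiner_residue2 e w : e < w -> e %% 27 = 25 ->
  'C(e + 2, 2) %| 'C(w - e.+1 + 2, 2) -> w %% 27 \in [:: 24; 25].
Proof.
move=> lt_ew e_mod /bin_dvd_ffact; rewrite !addn2 !ffactnS !ffactn0 /= !muln1.
move=> dvd; have dvd27 : 27 %| (w - e.+1).+2 * (w - e.+1).+1.
  by apply: dvdn_trans dvd; apply: dvdn_mulr; lia.
have [d3|nd3] := boolP (3 %| (w - e.+1).+2).
  rewrite Gauss_dvdl in dvd27; first by rewrite !inE; lia.
  by rewrite (@coprimeXl 3 3 _) // prime_coprime //; lia.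
rewrite Gauss_dvdr in dvd27; first by rewrite !inE; lia.
by rewrite (@coprimeXl 3 3 _) // prime_coprime.
Qed.

(** The factors of (e + 1)...(e + 7) divisible by 3 are e + 1, e + 4, each only
    once, and e + 7, at least three times. As 3 divides w - e, the factors
    w - e, w - e + 3 and w - e + 6 must supply the five factors 3, and two of
    the three supply only one each. *)
Lemma steiner_residue7 e w : e < w -> e %% 27 = 20 ->
    'C(e + 1, 1) %| 'C(w - e.+1 + 1, 1) -> 'C(e + 7, 7) %| 'C(w - e.+1 + 7, 7) ->
  w %% 27 \in [:: 14; 17; 20].
Proof.
move=> lt_ew e_mod; rewrite !bin1 !addn1 => dvd1 /bin_dvd_ffact.
have [E eqE] : exists E, e = 27 * E + 20 by exists (e %/ 27); lia.
have d3 : 3 %| (w - e.+1).+1 by apply: dvdn_trans dvd1; rewrite eqE; lia.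
have [V eqV] : exists V, (w - e.+1).+1 = 3 * V.
  by have [V ->] := dvdnP d3; exists V; rewrite mulnC.
rewrite !addnS !addn0 !ffactnS !ffactn0 /= !muln1 eqV => dvd.
pose U := (3 * V).+1 * (3 * V).+2 * ((3 * V).+4 * (3 * V).+4.+1).
have : 3 ^ 5 %| U * (3 ^ 3 * (V * V.+1 * V.+2)).
  have -> : U * (3 ^ 3 * (V * V.+1 * V.+2)) = (3 * V).+4.+2 * ((3 * V).+4.+1 * ((3 * V).+4
     * ((3 * V).+3 * ((3 * V).+2 * ((3 * V).+1 * (3 * V)))))) by rewrite /U; ring.
  apply: dvdn_trans dvd; rewrite eqE.
  apply/dvdnP; exists (E.+1 * (27 * E + 26) * (27 * E + 25) * (9 * E + 8)
    * (27 * E + 23) * (27 * E + 22) * (9 * E + 7)).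
  by ring.
rewrite Gauss_dvdr; last first.
  rewrite coprimeXl // !coprimeMr !prime_coprime //; lia.
rewrite (@expnD 3 3 2) dvdn_pmul2l // => dvd9.
have : (V %% 9 * (V %% 9).+1 * (V %% 9).+2) %% 9 = 0.
  have mod1 : (V %% 9).+1 = V.+1 %[mod 9] by rewrite -addn1 modnDml addn1.
  have mod2 : (V %% 9).+2 = V.+2 %[mod 9] by rewrite -addn2 modnDml addn2.
  have modM : V %% 9 * (V %% 9).+1 = V * V.+1 %[mod 9].
    by rewrite modnMml -modnMm mod1 modnMm.
  by rewrite -modnMm modM mod2 modnMm; apply/eqP.
have : V %% 9 < 9 by rewrite ltn_mod.
case eqV9: (V %% 9) => [|[|[|[|[|[|[|[|[|//]]]]]]]]] // _ _;
  rewrite !inE; clear -lt_ew eqE eqV eqV9; lia.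
Qed.

Lemma ball_size_div9 e w b : e < w -> e < b -> e %% 27 = 25 \/ e %% 27 = 20 ->
    (forall s, s <= e.+1 -> 'C(e + s, s) %| 'C(w - e.+1 + s, s)) ->
    (forall s, s <= e.+1 -> 'C(e + s, s) %| 'C(b - e.+1 + s, s)) ->
  9 %| ball_size w b e.
Proof.
move=> lt_ew lt_eb e_mod stw stb.
suff : [/\ w %% 27 <= e %% 27, b %% 27 <= e %% 27, carry 3 3 (w %% 27) (b %% 27)
    & carry 3 1 (w %% 27) (b %% 27) || carry 3 2 (w %% 27) (b %% 27)].
  by case=> *; apply: (@sq_dvd_ball_size 3).
case: e_mod => e_mod; rewrite e_mod.
  have := steiner_residue2 lt_ew e_mod (stw 2 _); have := steiner_residue2 lt_eb e_mod (stb 2 _).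
  have le2 : 2 <= e.+1 by lia.
  move=> /(_ le2); rewrite !inE => /orP[]/eqP-> /(_ le2) /orP[]/eqP->; by rewrite /carry.
have le7 : 7 <= e.+1 by lia.
have := steiner_residue7 lt_ew e_mod (stw 1 isT) (stw 7 le7).
have := steiner_residue7 lt_eb e_mod (stb 1 isT) (stb 7 le7).
by rewrite !inE => /or3P[]/eqP-> /or3P[]/eqP->; rewrite /carry.
Qed.

Lemma few_carries_ndvd p x y k0 : prime p ->
  (forall k, k != k0 -> ~~ carry p k x y) -> ~~ (p ^ 2 %| 'C(x + y, x)).
Proof.
move=> pr_p few; rewrite pfactor_dvdn ?bin_gt0 ?leq_addr // -ltnNge ltnS.
rewrite (kummer pr_p (leqnn (x + y))).
apply: (@leq_trans (\sum_(1 <= k < (x + y).+1) (k == k0))).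
  by apply: leq_sum => k _; case: eqP => [->|/eqP/few/negPf->] //; case: carry.
rewrite -big_mkcond /= sum1_count /=.
by rewrite count_uniq_mem ?iota_uniq // leq_b1.
Qed.

Lemma few_carries_top q N c x : q = 3 ^ N -> x < 3 * q -> c <= 2 ->
  ~~ (9 %| 'C(x + c * q, x)).
Proof.
move=> eq_q lt_x le_c; apply: (@few_carries_ndvd 3 _ _ N.+1) => // k neq_k.
rewrite /carry -ltnNge; have [le_kN|lt_Nk] := leqP k N.
  have -> : (c * q) %% 3 ^ k = 0.
    by apply/eqP; rewrite -/(_ %| _) dvdn_mull // eq_q dvdn_exp2l.
  by rewrite addn0 ltn_mod expn_gt0.
have : 3 ^ N.+2 <= 3 ^ k by rewrite leq_exp2l //; lia.
rewrite !expnS -eq_q; have := leq_mod x (3 ^ k); have := leq_mod (c * q) (3 ^ k).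
nia.
Qed.

Lemma no_carry_half h N : (2 * h).+1 = 3 ^ N -> ~~ (9 %| 'C(h + h, h)).
Proof.
move=> eq_h; apply: (@few_carries_ndvd 3 _ _ 0) => // k _.
rewrite /carry -ltnNge; have [le_kN|lt_Nk] := leqP k N.
  rewrite ltnNge; apply/negP=> ge_k.
  have dvd : 3 ^ k %| (2 * (h %% 3 ^ k)).+1.
    have : 3 ^ k %| (2 * h).+1 by rewrite eq_h dvdn_exp2l.
    by rewrite /dvdn -addn1 -modnDml -modnMmr modnDml addn1.
  have := ltn_mod h (3 ^ k); rewrite expn_gt0 /= => lt_h.
  have [m eqm] := dvdnP dvd.
  have : m < 2 by rewrite -(@ltn_pmul2r (3 ^ k)) ?expn_gt0 // -eqm; lia.
  by case: m eqm => [|[|//]] eqm _; lia.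
apply: (@leq_ltn_trans (h + h)); first by apply: leq_add; exact: leq_mod.
by apply: (@leq_trans (3 ^ N)); [rewrite -eq_h; lia | rewrite leq_exp2l // ltnW].
Qed.

(** Removing fewer than w / 2 elements in all from two almost equal numbers, one
    can reach an addition in base 3 with at most one carry. With q the largest
    power of 3 not exceeding w, the second number can be cut down to 2q or q, or both to
    11...1 in base 3, according to the size of b and w relative to q. *)
Lemma digit_choice w b : 60 <= w -> w <= b -> 8 * b <= 9 * w ->
  exists x y, [/\ x <= w, y <= b, 2 * ((w - x) + (b - y)) < w
                & ~~ (9 %| 'C(x + y, x))].
Proof.
move=> ge_w le_wb le_b.
have /andP[le_qw lt_wq] : 3 ^ trunc_log 3 w <= w < 3 ^ (trunc_log 3 w).+1.
  by apply: trunc_log_bounds => //; lia.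
set N := trunc_log 3 w in le_qw lt_wq; pose q := 3 ^ N.
have eq_q3 : 3 ^ N.+1 = 3 * q by rewrite expnS.
rewrite eq_q3 in lt_wq; rewrite -/q in le_qw.
have [le_2q|lt_2q] := leqP (2 * q) b.
  exists w, (2 * q); split => //; first by lia.
  exact: (@few_carries_top q N).
(* (3q - 1) / 2 has all its digits in base 3 equal to 1. *)
have [lt_w|ge_half] := ltnP (2 * w) (3 * q - 1).
  exists w, (1 * q); split => //; try lia.
  exact: (@few_carries_top q N).
have odd_q : odd (3 * q) by rewrite -eq_q3 oddX orbT.
have eq_h : (2 * (3 * q)./2).+1 = 3 ^ N.+1 by rewrite eq_q3; lia.
exists (3 * q)./2, (3 * q)./2; split; try lia.
exact: (no_carry_half eq_h).
Qed.

(** * Nonexistence *)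

(** Otherwise w >= 2e^2 + 4e + 1, which makes the code a t-design for every
    t < w / 2. The ball size, a multiple of 9, then divides the binomial
    coefficient of digit_choice. *)
Lemma perfect_trivial_parameters (T : finType) w b e (C : {set {set T}}) :
    #|T| = w + b -> perfect w e C -> 7 < e -> e %% 27 = 25 \/ e %% 27 = 20 ->
    e < w -> w <= b ->
  w = 2 * e + 1 /\ b = 2 * e + 1.
Proof.
move=> card_T perfC lt7e e_mod lt_ew le_wb; have lt_eb := leq_trans lt_ew le_wb.
have e_gt0 : 0 < e by lia.
have [//|large] := perfect_lower_bound card_T perfC e_gt0 lt_ew le_wb.
have div9 : 9 %| ball_size w b e.
  apply: ball_size_div9 => // s le_s; first exact: (steiner_dvd card_T perfC).
  have card_T' : #|T| = b + w by rewrite addnC.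
  exact: (steiner_dvd card_T' (perfectC card_T perfC)).
have roos := roos_bound card_T perfC e_gt0 lt_ew lt_eb.
have ge_w : 60 <= w by clear -large lt7e; nia.
have le_b : 8 * b <= 9 * w.
  clear -roos le_wb lt7e lt_ew.
  have [D eqD] : exists D, b = w + D by exists (b - w); lia.
  have [u equ] : exists u, w = e.+1 + u by exists (w - e.+1); lia.
  have le_D : e * D <= u.
    move: roos; have -> : w - e.+1 = u by lia.
    have -> : b - e = u + D.+1 by lia.
    nia.
  have : 8 * D <= e * D by rewrite leq_mul2r lt7e orbT.
  lia.
have [x [y [le_x le_y lt_t ndvd]]] := digit_choice ge_w le_wb le_b.
case/negP: ndvd; apply: dvdn_trans div9 _.
set t := w - x + (b - y) in lt_t.
have [u equ] : exists u, w = t + u by exists (w - t); lia.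
have [z eqz] : exists z, u = z + (e ^ 2 + 2 * e + 1).
  by exists (u - (e ^ 2 + 2 * e + 1)); rewrite subnK //; clear -equ lt_t large; lia.
apply: (@ball_size_dvd _ w b e t C) => //.
- by clear -equ eqz; nia.
- by clear -equ eqz le_wb; nia.
apply: (@leq_trans ((w - t - e).+1 * (w - t - e).+1)); last by apply: leq_mul; lia.
have -> : w - t - e = z + e ^ 2 + e + 1 by clear -equ eqz; lia.
apply: (@leq_ltn_trans ((z + e ^ 2 + 2 * e) * e ^ 2)).
  by rewrite leq_mul2r; apply/orP; right; clear -equ eqz lt_t; lia.
by nia.
Qed.

Lemma perfect_code_perfect n w e (C : {set {set 'I_n}}) :
  perfect_code w e C -> perfect w e C.
Proof.
case=> sCJ inj /and3P[/eqP coverC trivC _]; split=> [X XC|Y cY].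
  by have := subsetP sCJ X XC; rewrite inE => /eqP.
have YJ : Y \in johnson n w by rewrite inE cY.
have in_ball X : (Y \in jball w e X) = (#|X :\: Y| <= e) by rewrite inE YJ.
have : Y \in cover [set jball w e X | X in C] by rewrite coverC.
case/bigcupP=> _ /imsetP[X XC ->] YX.
apply/eqP/cards1P; exists X; apply/setP=> Z; rewrite !inE.
apply/andP/eqP=> [[ZC dZ]|->]; last by rewrite XC -in_ball.
apply: inj => //; apply/eqP/negPn/negP=> neq.
have := trivIsetP trivC _ _ (imset_f _ ZC) (imset_f _ XC) neq.
by move/pred0P/(_ Y); rewrite /= YX in_ball dZ.
Qed.

Lemma nontrivial_two_words (T : finType) w b e (C : {set {set T}}) :
    #|T| = w + b -> perfect w e C -> #|C| <> 1 ->
  exists X Z, [/\ X \in C, Z \in C & 2 * e < #|X :\: Z|].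
Proof.
move=> card_T perfC ncard1; have [X XC] := perfect_nonempty perfC card_T.
have [Z /andP[ZC neq]|none] := pickP (fun Z => (Z \in C) && (Z != X)).
  by exists X, Z; split=> //; rewrite (perfect_min_dist perfC) // eq_sym.
case: ncard1; apply/eqP/cards1P; exists X; apply/setP=> Z; rewrite inE.
have := none Z; case: (Z =P X) => [->|_] /=; first by rewrite XC.
by rewrite andbT.
Qed.

Theorem theorem4p4 (k e : nat) (hk : 3 <= k) (he : 7 < e)
  (hmod : (e%:Z = - 2%:Z %[mod 3%:Z ^+ k])%Z \/
          (e%:Z = - 7%:Z %[mod 3%:Z ^+ k])%Z)
  (n w : nat) (hw : 1 <= w <= n - 1) :
  ~ exists C : {set {set 'I_n}},
      perfect_code w e C /\ ~ trivial_code w e C.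
Proof.
case=> C [/perfect_code_perfect perfC nontriv].
have e_mod : e %% 27 = 25 \/ e %% 27 = 20.
  have mod27 (a : int) : (e%:Z = a %[mod 3%:Z ^+ k])%Z -> (27%:Z %| (e%:Z - a)%R)%Z.
    move/eqP; rewrite eqz_mod_dvd; apply: dvdz_trans.
    by rewrite -(subnK hk) GRing.exprD dvdz_mull.
  by case: hmod => /mod27 dvd27; [left | right]; clear -dvd27; lia.
pose b := n - w.
have card_T : #|'I_n| = w + b by rewrite card_ord subnKC //; lia.
have ncard1 : #|C| <> 1 by move=> card1; apply: nontriv; apply: Or32.
have [X [Z [XC ZC lt_d]]] := nontrivial_two_words card_T perfC ncard1.
have cX := perfC.1 X XC.
have lt_ew : e < w.
  have := subset_leq_card (subsetDl X Z); rewrite cX; apply: leq_trans.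
  by apply: leq_ltn_trans lt_d; rewrite leq_pmull.
have cXC : #|~: X| = b by have := cardsC X; rewrite cX card_T; clear; lia.
have lt_eb : e < b.
  have := subset_leq_card (subsetDl (~: X) (~: Z)).
  rewrite setCD_C (code_setDC perfC XC ZC) cXC; apply: leq_trans.
  by apply: leq_ltn_trans lt_d; rewrite leq_pmull.
have [lt_bw|le_wb] := ltnP b w.
  have card_T' : #|'I_n| = b + w by rewrite addnC.
  have [] := perfect_trivial_parameters card_T' (perfectC card_T perfC) he e_mod lt_eb (ltnW lt_bw).
  by clear -lt_bw; lia.
have [ew eb] := perfect_trivial_parameters card_T perfC he e_mod lt_ew le_wb.
apply: nontriv; apply: Or33; split=> //; first by rewrite /b in eb; lia.
exists X; first by rewrite inE cX.
have oppositeX V : V \in C -> V != X -> V = ~: X.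
  move=> VC neq; have := perfect_min_dist perfC VC XC neq.
  have dV := subset_leq_card (subsetDl V X).
  have cV := perfC.1 V VC; move=> lt_dV.
  have eqV : V :\: X = V.
    by apply/eqP; rewrite eqEcard subsetDl cV; clear -lt_dV ew; lia.
  apply/eqP; rewrite eqEcard -{1}eqV setDE subsetIr cXC cV /=; clear -ew eb; lia.
have neqZX : Z != X.
  by apply: contraTneq lt_d => ->; rewrite setDv cards0.
have eqZ := oppositeX Z ZC neqZX.
apply/setP=> V; rewrite !inE; apply/idP/orP=> [VC|[/eqP->|/eqP->]] //; last by rewrite -eqZ.
by case: (V =P X) => [|/eqP neq]; [left | right; rewrite (oppositeX V)].
Qed.
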